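(* Fix $b\ge2$, $\beta\ge0$, $h\in\mathbb{R}$ and a boundary condition $\tau$. (a) For any integer $\ell\ge1$ and any $\delta\in(0,1]$, and any finite complete subtree $T$, if $\mu=\mu_T^\tau$ satisfies $\mathrm{VM}\bigl(\ell,\tfrac{1-\delta}{2(\ell+1-\delta)}\bigr)$, then $\mathrm{Var}(f)\le\frac{3}{\delta}\,\mathcal{D}_\ell(f)$ for all $f:\Omega\to\mathbb{R}$. (b) In particular, if there are fixed $\ell\ge 1$ and $\delta\in(0,1]$ such that $\mu_T^\tau$ satisfies $\mathrm{VM}\bigl(\ell,\tfrac{1-\delta}{2(\ell+1-\delta)}\bigr)$ for every finite complete subtree $T$, then $c_{\mathrm{gap}}(\mu)=\Omega(1)$, i.e. there is a constant $C>0$ with $c_{\mathrm{gap}}(\mu_T^\tau)\ge1/C$ for every $T$. (c) Conversely, if $c_{\mathrm{gap}}(\mu)=\Omega(1)$, i.e. there is a constant $C>0$ with $c_{\mathrm{gap}}(\mu_T^\tau)\ge1/C$ for every $T$, then there exist constants $c,\vartheta>0$ such that for all $T$ and all $\ell$, $\mu_T^\tau$ satisfies $\mathrm{VM}(\ell,ce^{-\vartheta\ell})$.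
   Context: Setting. Fix an integer $b\ge2$, $\beta\ge0$ (inverse temperature) and $h\in\mathbb{R}$ (external field). $\mathbb{T}^b$ is the infinite rooted tree in which every vertex has $b$ children. $T$ denotes a finite complete subtree: for some vertex $r$ (the root of $T$) and some $m\ge0$, $T$ consists of $r$ and all its descendants at distance at most $m$ from $r$. $\partial T$ is the set of children in $\mathbb{T}^b$ of the leaves of $T$; only edges inside $T\cup\partial T$ are considered. For $A\subseteq T$, $\partial A$ is the set of vertices of $(T\cup\partial T)\setminus A$ adjacent to $A$, and $E(A\cup\partial A)$ is the set of edges with both endpoints in $A\cup\partial A$. A boundary condition is a configuration $\tau\in\{\pm1\}^{\mathbb{T}^b}$; $\Omega=\Omega_T^\tau$ is the set of $\sigma\in\{\pm1\}^{T\cup\partial T}$ agreeing with $\tau$ on $\partial T$. For $\eta\in\Omega$ and $A\subseteq T$, $\mu_A^\eta$ is the probability measure on $\Omega$ with $\mu_A^\eta(\sigma)\propto\exp[\beta(\sum_{xy\in E(A\cup\partial A)}\sigma_x\sigma_y+h\sum_{x\in A}\sigma_x)]$ if $\sigma$ agrees with $\eta$ outside $A$, and $\mu_A^\eta(\sigma)=0$ otherwise. $\mu=\mu_T^\tau$ is the case $A=T$. $\mu_A^\eta(f)$ is the expectation of $f:\Omega\to\mathbb{R}$, $\mathrm{Var}_A^\eta(f)=\mu_A^\eta(f^2)-\mu_A^\eta(f)^2$; viewed as functions of $\eta$ these are written $\mu_A(f),\mathrm{Var}_A(f)$. $\mathrm{Var}$ without subscripts is with respect to $\mu$. Spectral gap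 (heat-bath Glauber dynamics): $\mathcal{D}(f)=\sum_{x\in T}\mu(\mathrm{Var}_{\{x\}}(f))$ and $c_{\mathrm{gap}}(\mu)=\inf_f\mathcal{D}(f)/\mathrm{Var}(f)$ over non-constant $f:\Omega\to\mathbb{R}$. Blocks. For $x\in T$, $T_x$ is the subtree of $T$ consisting of $x$ and all its descendants in $T$, $\widetilde{T_x}=T_x\setminus\{x\}$, and $B_{x,\ell}\subseteq T_x$ is the set of vertices of $T_x$ at distance at most $\ell-1$ from $x$ (the first $\ell$ levels of $T_x$; all of $T_x$ if $T_x$ has fewer than $\ell$ levels). $\mathcal{D}_\ell(f)=\sum_{x\in T}\mu[\mathrm{Var}_{B_{x,\ell}}(f)]$. Variance Mixing. $\mu=\mu_T^\tau$ satisfies $\mathrm{VM}(\ell,\varepsilon)$ if for every $x\in T$, every $\eta\in\Omega_T^\tau$ and every function $f:\Omega\to\mathbb{R}$ that does not depend on the spins in $B_{x,\ell}$, one has $\mathrm{Var}^\eta_{T_x}[\mu_{\widetilde{T_x}}(f)]\le\varepsilon\,\mathrm{Var}^\eta_{T_x}(f)$. *)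

(* Defs.v *)
From HB Require Import structures.
From mathcomp Require Import all_boot all_order all_algebra.
From mathcomp Require Import classical_sets reals sequences exp.

Set Implicit Arguments.
Unset Strict Implicit.
Unset Printing Implicit Defensive.

Import Order.TTheory GRing.Theory Num.Theory.
Local Open Scope ring_scope.

(* A vertex of the rooted b-ary tree is the path leading to it from the root:
   the children of v are the vertices [rcons v i], its descendants at distance
   k are the [v ++ w] with [size w = k]. *)
Definition tree (b : nat) := seq 'I_b.

(* Spins: [true] stands for +1 and [false] for -1. *)
Definition sgn (R : realType) (s : bool) : R := if s then 1 else -1.

Section Subtree.
Variables (b : nat) (m : nat).

(* T is the complete subtree with root r and depth m.  The vertex [r ++ u] of
   T together with its boundary is represented by its position u relative to
   r, a sequence of length at most m.+1; it lies in T iff [size u <= m]. *)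
Definition vertex := m.+1.-bseq 'I_b.

Implicit Types (x y : vertex) (A : {set vertex}).

Definition subtree : {set vertex} := [set x : vertex | (size x <= m)%N].

Definition child x y := [exists i : 'I_b, (y : seq 'I_b) == rcons x i].

Definition adj x y := child x y || child y x.

Definition bd A : {set vertex} :=
  [set y | (y \notin A) && [exists x, (x \in A) && adj x y]].

Definition clos A : {set vertex} := A :|: bd A.

Definition below x : {set vertex} := [set y in subtree | prefix x y].

Definition sbelow x : {set vertex} := below x :\ x.

(* y is a descendant of x, so this says its distance to x is at most l - 1. *)
Definition block x (l : nat) : {set vertex} :=
  [set y in below x | (size y < size x + l)%N].

End Subtree.

Section Gibbs.
Variables (R : realType) (b : nat) (beta h : R).
Variables (tau : tree b -> bool) (r : tree b) (m : nat).

Let V := vertex b m.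
Let T := subtree b m.

Definition on_bdry (s : {ffun V -> bool}) : bool :=
  [forall x, (x \notin T) ==> (s x == tau (r ++ x))].

(* Omega_T^tau *)
Definition conf := {s : {ffun V -> bool} | on_bdry s}.

Definition at_ (s : conf) (x : V) : bool := val s x.

Lemma tau_on_bdry : on_bdry [ffun x : V => tau (r ++ x)].
Proof. by apply/forallP => x; rewrite ffunE eqxx implybT. Qed.

Definition tau_conf : conf := exist (fun s => is_true (on_bdry s)) _ tau_on_bdry.

Implicit Types (A : {set V}) (eta s : conf) (f : conf -> R).

Definition agree_off A eta s : bool :=
  [forall x, (x \notin A) ==> (at_ s x == at_ eta x)].

(* Summing over (parent, child) pairs counts each edge exactly once. *)
Definition weight A s : R :=
  expR (beta *
    (\sum_(p : V * V | [&& child p.1 p.2, p.1 \in clos A & p.2 \in clos A])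
        sgn R (at_ s p.1) * sgn R (at_ s p.2)
     + h * \sum_(x in A) sgn R (at_ s x))).

Definition mu A eta s : R :=
  if agree_off A eta s
  then weight A s / \sum_(s' | agree_off A eta s') weight A s'
  else 0.

Definition expect A eta f : R := \sum_s mu A eta s * f s.

Definition variance A eta f : R :=
  expect A eta (fun s => f s ^+ 2) - expect A eta f ^+ 2.

Definition expectT f : R := expect T tau_conf f.
Definition varT f : R := variance T tau_conf f.

Definition dirichlet f : R :=
  \sum_(x in T) expectT (fun eta => variance [set x] eta f).

Definition nonconstant f : Prop := exists s s', f s <> f s'.

(* The set is nonempty and bounded below by 0, so [inf] is its true infimum. *)
Definition cgap : R :=
  inf [set dirichlet f / varT f | f in [set f | nonconstant f]]%classic.

Definition dirichlet_block (l : nat) f : R :=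
  \sum_(x in T) expectT (fun eta => variance (block x l) eta f).

Definition indep_of A f : Prop := forall s s', agree_off A s s' -> f s = f s'.

Definition VM (l : nat) (eps : R) : Prop :=
  forall (x : V) (eta : conf) (f : conf -> R),
    x \in T -> indep_of (block x l) f ->
    variance (below x) eta (fun s => expect (sbelow x) s f)
      <= eps * variance (below x) eta f.

End Gibbs.

(* Main.v *)
Require Import Defs.
From mathcomp Require Import all_boot all_order all_algebra.
From mathcomp Require Import boolp reals sequences exp.
From mathcomp Require Import zify ring lra.

(** Write E_A for the conditional expectation given the spins off A; in
    L2(mu) these are orthogonal projections, nested for nested sets, and
    E_A E_C = E_C E_A = E_{A u C} when A and C are disjoint and non-adjacent.
    With N f = mu(f^2), the averaged conditional variance mu(Var_A f) is
    N f - N (E_A f).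

    (a) Put P_x(f) = mu(Var_{T_x}(mu_{T_x \ x} f)). Peeling off vertices from
    the top gives Var f <= sum_x P_x(f).  If g is f averaged over the levels of
    T_x beyond the first l + 1, then P_x(g) = P_x(f); splitting
    g = (g - mu_B g) + mu_B g with B = B_{x,l} and applying VM to mu_B g yields
    (1 - 2 eps) P_x(f) <= (2 - 2 eps) mu(Var_B f)
                          + 2 eps sum_{y below x, d(x,y) <= l} P_y(f).
    Summing over x, each P_y is counted at most l times.

    (b) Blocks have bounded size, and adding one site to a set costs a bounded
    factor in the Poincare inequality because single-spin conditional
    probabilities are bounded below.

    (c) The gap of T passes to mu_{T_x}^eta (only the spin of the parent of x
    matters).  Let k = mu_{T_x \ x}(f), a function of the spin at x, and run the
    heat bath for k on T_x but updating only spins in B; this does not change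
    the covariance with f.  The influence of the spin at x spreads at finite
    speed, so for a time proportional to l this dynamics is exponentially close
    to the full one, which contracts the variance at a constant rate. *)

Set Implicit Arguments.
Unset Strict Implicit.
Unset Printing Implicit Defensive.

Import Order.TTheory GRing.Theory Num.Theory.
Local Open Scope ring_scope.

(** * Conditional expectations *)

Section Configurations.
Variables (b : nat) (tau : tree b -> bool) (r : tree b) (m : nat).
Local Notation V := (vertex b m).
Local Notation T := (subtree b m).
Local Notation conf := (conf tau r m).
Implicit Types (A C D : {set V}) (s t eta : conf) (x y : V).

Lemma agree_offP A eta s :
  reflect (forall x, x \notin A -> at_ s x = at_ eta x) (agree_off A eta s).
Proof.
apply: (iffP forallP) => [H x xA|H x].
  by apply/eqP; have := H x; rewrite xA.
by apply/implyP => xA; rewrite H.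
Qed.

Lemma agree_refl A s : agree_off A s s.
Proof. exact/agree_offP. Qed.

Lemma agree_sym A s t : agree_off A s t = agree_off A t s.
Proof. by apply/agree_offP/agree_offP => H x /H. Qed.

Lemma agree_trans A s t u : agree_off A s t -> agree_off A t u -> agree_off A s u.
Proof.
by move=> /agree_offP H1 /agree_offP H2; apply/agree_offP => x xA; rewrite H2 ?H1.
Qed.

Lemma agree_eqr A s t u : agree_off A s t -> agree_off A s u = agree_off A t u.
Proof.
move=> st; apply/idP/idP; last exact: agree_trans.
by apply: agree_trans; rewrite agree_sym.
Qed.

Lemma agreeW A D s t : A \subset D -> agree_off A s t -> agree_off D s t.
Proof.
move=> AD /agree_offP H; apply/agree_offP => x xD; apply: H.
by apply: contra xD; apply: (subsetP AD).
Qed.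

Lemma at_bdry s t x : x \notin T -> at_ s x = at_ t x.
Proof.
move=> xT; have bd (u : conf) : at_ u x = tau (r ++ x).
  by have /forallP/(_ x)/implyP/(_ xT)/eqP := svalP u.
by rewrite !bd.
Qed.

Lemma conf_ext s t : (forall x, at_ s x = at_ t x) -> s = t.
Proof. by move=> H; apply/val_inj/ffunP. Qed.

Lemma patch_on_bdry C s t :
  on_bdry tau r [ffun x : V => if x \in C then at_ s x else at_ t x].
Proof.
apply/forallP => x; apply/implyP => xT; rewrite ffunE.
have /forallP/(_ x)/implyP/(_ xT) := svalP s.
have /forallP/(_ x)/implyP/(_ xT) := svalP t.
by case: ifP.
Qed.

Definition patch C s t : conf :=
  exist (fun u => is_true (on_bdry tau r u)) _ (patch_on_bdry C s t).

Lemma at_patch C s t x : at_ (patch C s t) x = if x \in C then at_ s x else at_ t x.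
Proof. by rewrite /at_ /= ffunE. Qed.

Lemma patch_agree C s t : agree_off C t (patch C s t).
Proof. by apply/agree_offP => x xC; rewrite at_patch (negbTE xC). Qed.

Lemma patchK A s t : agree_off A t s -> patch A s t = s.
Proof.
move=> /agree_offP H; apply: conf_ext => x; rewrite at_patch.
by case: ifPn => // /H ->.
Qed.

End Configurations.

Section Expectation.
Variables (R : realType) (b : nat) (beta h : R).
Variables (tau : tree b -> bool) (r : tree b) (m : nat).
Local Notation V := (vertex b m).
Local Notation T := (subtree b m).
Local Notation conf := (conf tau r m).
Local Notation mu := (Defs.mu beta h).
Local Notation weight := (Defs.weight beta h).
Implicit Types (A C D : {set V}) (s t eta : conf) (x y : V) (f g u : conf -> R).

Definition condexp A f : conf -> R := fun eta => expect beta h A eta f.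
Local Notation E := condexp.

Lemma weight_gt0 A s : 0 < weight A s.
Proof. exact: expR_gt0. Qed.

Lemma partition_gt0 A eta : 0 < \sum_(s | agree_off A eta s) weight A s.
Proof.
rewrite (bigD1 eta) ?agree_refl //=; apply: ltr_wpDr (weight_gt0 _ _).
by apply: sumr_ge0 => *; exact/ltW/weight_gt0.
Qed.

Lemma mu_ge0 A eta s : 0 <= mu A eta s.
Proof.
rewrite /Defs.mu; case: ifP => // _.
by rewrite divr_ge0 ?ltW ?weight_gt0 ?partition_gt0.
Qed.

Lemma mu_gt0 A eta s : agree_off A eta s -> 0 < mu A eta s.
Proof. by move=> H; rewrite /Defs.mu H divr_gt0 ?weight_gt0 ?partition_gt0. Qed.

Lemma mu_off A eta s : ~~ agree_off A eta s -> mu A eta s = 0.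
Proof. by rewrite /Defs.mu => /negbTE ->. Qed.

Lemma sum_mu A eta : \sum_s mu A eta s = 1.
Proof.
rewrite /Defs.mu -big_mkcond /= -mulr_suml divff //.
exact/lt0r_neq0/partition_gt0.
Qed.

Lemma mu_class A eta eta' s : agree_off A eta eta' -> mu A eta s = mu A eta' s.
Proof.
move=> H; rewrite /Defs.mu (agree_eqr _ H).
by congr (if _ then _ / _ else _); apply: eq_bigl => t; exact: agree_eqr.
Qed.

Lemma clos_sub A D : A \subset D -> clos A \subset clos D.
Proof.
move=> AD; apply/subsetP => y; rewrite !inE => /orP[/(subsetP AD) -> //|].
case/andP=> yA /existsP[x /andP[xA xy]].
by case: (boolP (y \in D)) => //= _; apply/existsP; exists x; rewrite (subsetP AD).
Qed.

(** An edge with an endpoint in A lies inside [clos A], so the factors of [weight D] missing from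
    [weight A] see no spin of A. The ratio of the two weights is therefore the same at s and t. *)
Lemma weight_exchange A D s t : A \subset D -> agree_off A s t ->
  weight D s * weight A t = weight D t * weight A s.
Proof.
move=> AD st; rewrite /Defs.weight -!expRD; congr expR; rewrite -!mulrDr.
congr (beta * _).
have splitp (u : conf) : \sum_(p : V * V | [&& child p.1 p.2, p.1 \in clos D & p.2 \in clos D])
      sgn R (at_ u p.1) * sgn R (at_ u p.2) =
    \sum_(p : V * V | [&& child p.1 p.2, p.1 \in clos A & p.2 \in clos A])
      sgn R (at_ u p.1) * sgn R (at_ u p.2) +
    \sum_(p : V * V | [&& child p.1 p.2, p.1 \in clos D & p.2 \in clos D]
       && ~~ ((p.1 \in clos A) && (p.2 \in clos A)))
      sgn R (at_ u p.1) * sgn R (at_ u p.2).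
  rewrite (bigID (fun p => (p.1 \in clos A) && (p.2 \in clos A))) /=.
  congr (_ + _); apply: eq_bigl => p.
  have /subsetP S := clos_sub AD.
  case: (boolP (p.1 \in clos A)) => [/S ->|]; case: (boolP (p.2 \in clos A)) => [/S ->|];
   by rewrite /= ?andbT ?andbF.
have splitv (u : conf) : \sum_(x in D) sgn R (at_ u x) =
    \sum_(x in A) sgn R (at_ u x) + \sum_(x in D | x \notin A) sgn R (at_ u x).
  rewrite (bigID (fun x => x \in A)) /=; congr (_ + _); apply: eq_bigl => x.
  by case: (boolP (x \in A)) => [/(subsetP AD) ->|]; rewrite ?andbF.
rewrite !splitp !splitv.
have -> : \sum_(x in D | x \notin A) sgn R (at_ s x) =
          \sum_(x in D | x \notin A) sgn R (at_ t x).
  by apply: eq_bigr => x /andP[_ xA]; rewrite (agree_offP _ _ _ st).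
suff -> : \sum_(p : V * V | [&& child p.1 p.2, p.1 \in clos D & p.2 \in clos D]
       && ~~ ((p.1 \in clos A) && (p.2 \in clos A)))
      sgn R (at_ s p.1) * sgn R (at_ s p.2) =
   \sum_(p : V * V | [&& child p.1 p.2, p.1 \in clos D & p.2 \in clos D]
       && ~~ ((p.1 \in clos A) && (p.2 \in clos A)))
      sgn R (at_ t p.1) * sgn R (at_ t p.2) by ring.
apply: eq_bigr => -[x y] /= /andP[/and3P[xy _ _]] H.
have xA : x \notin A.
  apply: contra H => xA; rewrite !inE xA /=.
  by case: (boolP (y \in A)) => //= yA; apply/existsP; exists x; rewrite xA /adj xy.
have yA : y \notin A.
  apply: contra H => yA; rewrite !inE yA andbT.
  by case: (boolP (x \in A)) => //= _; apply/existsP; exists y; rewrite yA /adj xy orbT.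
by rewrite !(agree_offP _ _ _ st).
Qed.

(** Consistency of Gibbs measures: within a class of configurations agreeing off A, the weight of
    any larger set gives the same normalized law as [weight A]. *)
Lemma muE A D eta s : A \subset D -> agree_off A eta s ->
  mu A eta s = weight D s / \sum_(t | agree_off A eta t) weight D t.
Proof.
move=> AD es; rewrite /Defs.mu es.
have H : 0 < \sum_(t | agree_off A eta t) weight D t.
  rewrite (bigD1 eta) ?agree_refl //=; apply: ltr_wpDr (weight_gt0 _ _).
  by apply: sumr_ge0 => *; exact/ltW/weight_gt0.
apply/eqP; rewrite eqr_div ?lt0r_neq0 ?partition_gt0 //; apply/eqP.
rewrite mulrC !mulr_sumr mulr_suml; apply: eq_bigr => t et.
by apply: weight_exchange AD _; apply: agree_trans es; rewrite agree_sym.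
Qed.

(** Detailed balance for resampling A under [mu D]; this is what makes [E A] self-adjoint. *)
Lemma mu_balance A D eta s t : A \subset D ->
  mu D eta s * mu A s t = mu D eta t * mu A t s.
Proof.
move=> AD; case: (boolP (agree_off A s t)) => st; last first.
  have ts : ~~ agree_off A t s by rewrite agree_sym.
  by rewrite (mu_off st) (mu_off ts) !mulr0.
rewrite [mu A s t](mu_class _ st).
case: (boolP (agree_off D eta s)) => es; last first.
  have et : ~~ agree_off D eta t.
    apply: contra es => et; apply: agree_trans et _.
    by rewrite agree_sym; exact: agreeW st.
  by rewrite (mu_off es) (mu_off et) !mul0r.
have et : agree_off D eta t by apply: agree_trans es _; exact: agreeW st.
have ts : agree_off A t s by rewrite agree_sym.
rewrite (muE (subxx A) ts) (muE (subxx A) (agree_refl A t)).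
rewrite (muE (subxx D) es) (muE (subxx D) et).
rewrite mulrACA [RHS]mulrACA; congr (_ * _); exact: weight_exchange.
Qed.

Lemma E_eq A f g eta : (forall s, agree_off A eta s -> f s = g s) ->
  E A f eta = E A g eta.
Proof.
move=> H; apply: eq_bigr => s _; case: (boolP (agree_off A eta s)) => es.
  by rewrite H.
by rewrite mu_off ?mul0r.
Qed.

Lemma E_le A f g eta : (forall s, agree_off A eta s -> f s <= g s) ->
  E A f eta <= E A g eta.
Proof.
move=> H; apply: ler_sum => s _; case: (boolP (agree_off A eta s)) => es.
  by rewrite ler_wpM2l ?mu_ge0 ?H.
by rewrite mu_off ?mul0r.
Qed.

Lemma E_const A c eta : E A (fun=> c) eta = c.
Proof. by rewrite /condexp /expect -mulr_suml sum_mu mul1r. Qed.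

Lemma E_ge0 A f eta : (forall s, agree_off A eta s -> 0 <= f s) -> 0 <= E A f eta.
Proof. by move=> H; rewrite -(E_const A 0 eta); apply: E_le. Qed.

Lemma E_add A f g : E A (fun s => f s + g s) = fun s => E A f s + E A g s.
Proof.
by apply: funext => s; rewrite /condexp /expect -big_split; apply: eq_bigr => *; rewrite mulrDr.
Qed.

Lemma E_scale A c f : E A (fun s => c * f s) = fun s => c * E A f s.
Proof.
by apply: funext => s; rewrite /condexp /expect mulr_sumr; apply: eq_bigr => *; rewrite mulrCA.
Qed.

Lemma E_opp A f : E A (fun s => - f s) = fun s => - E A f s.
Proof.
by apply: funext => s; rewrite /condexp /expect -sumrN; apply: eq_bigr => *; rewrite mulrN.
Qed.

Lemma E_sub A f g : E A (fun s => f s - g s) = fun s => E A f s - E A g s.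
Proof. by rewrite E_add E_opp. Qed.

Lemma E_sum A (I : Type) (rr : seq I) (P : pred I) (F : I -> conf -> R) :
  E A (fun s => \sum_(i <- rr | P i) F i s) = fun s => \sum_(i <- rr | P i) E A (F i) s.
Proof.
apply: funext => s; rewrite /condexp /expect exchange_big /=.
by apply: eq_bigr => t _; rewrite mulr_sumr.
Qed.

Lemma E_indep A f : indep_of A (E A f).
Proof. by move=> s t st; apply: eq_bigr => u _; rewrite (mu_class _ st). Qed.

Lemma indepW A D f : A \subset D -> indep_of D f -> indep_of A f.
Proof. by move=> AD H s t st; apply: H; exact: agreeW st. Qed.

Lemma E_id A g : indep_of A g -> E A g = g.
Proof.
move=> ig; apply: funext => s; rewrite (@E_eq _ _ (fun=> g s)) ?E_const //.
by move=> t /ig ->.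
Qed.

Lemma E_selfadj A D f g eta : A \subset D ->
  E D (fun s => E A f s * g s) eta = E D (fun s => f s * E A g s) eta.
Proof.
move=> AD; rewrite /condexp /expect.
under eq_bigr do rewrite mulrA mulr_sumr mulr_suml.
rewrite exchange_big /=; apply: eq_bigr => t _.
rewrite !mulr_sumr; apply: eq_bigr => s _.
rewrite mulrA (mu_balance _ _ _ AD); ring.
Qed.

(** Self-adjointness of [E A] tested against the constant 1. *)
Lemma E_tower A D f : A \subset D -> E D (E A f) = E D f.
Proof.
move=> AD; apply: funext => eta.
have := E_selfadj f (fun=> 1) eta AD.
under [in X in X = _]E_eq do rewrite mulr1.
by move=> ->; apply: E_eq => s _; rewrite E_const mulr1.
Qed.

Lemma E_tower_in A D f : A \subset D -> E A (E D f) = E D f.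
Proof. by move=> AD; apply: E_id; apply: indepW AD _; exact: E_indep. Qed.

Lemma varianceE A f eta :
  variance beta h A eta f = E A (fun s => (f s - E A f s) ^+ 2) eta.
Proof.
have -> : E A (fun s => (f s - E A f s) ^+ 2) eta =
          E A (fun s => f s ^+ 2 + ((- 2 * E A f eta) * f s + (E A f eta) ^+ 2)) eta.
  by apply: E_eq => s es; rewrite -(E_indep f es); ring.
rewrite !E_add E_scale E_const /variance -!/(condexp _ _ _); ring.
Qed.

End Expectation.

(** * Commutation and averaged variances *)

(** Since [clos C] adds the neighbours of C, this excludes common vertices and edges between A and
    C. It is the condition under which [E A] and [E C] commute. *)
Definition separated (b m : nat) (A C : {set vertex b m}) := [disjoint A & clos C].

Lemma separated_sym (b m : nat) (A C : {set vertex b m}) :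
  separated A C -> separated C A.
Proof.
move=> /pred0P H; apply/pred0P => x /=; apply/negP => /andP[xC].
have := H x; rewrite /= !inE xC /= andbT => xA; rewrite xA /=.
case/existsP=> y /andP[yA yx]; have := H y; rewrite /= !inE yA /=.
move/negbT; rewrite negb_or => /andP[-> /=] /existsP; apply; exists x.
by rewrite xC /adj orbC.
Qed.

Lemma separatedS (b m : nat) (A A' C : {set vertex b m}) :
  A' \subset A -> separated A C -> separated A' C.
Proof. exact: disjointWl. Qed.

Lemma separated_disjoint (b m : nat) (A C : {set vertex b m}) :
  separated A C -> [disjoint A & C].
Proof. by apply: disjointWr; exact: subsetUl. Qed.

Lemma ratio_le (R : realType) (M N N' Z Z' : R) : 0 <= N -> 0 < Z -> 0 < Z' ->
  N <= M * N' -> Z' <= M * Z -> N / Z <= M ^+ 2 * (N' / Z').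
Proof.
move=> N0 Z0 Z'0 NN ZZ; rewrite ler_pdivrMr // mulrA mulrAC ler_pdivlMr //.
have -> : M ^+ 2 * N' * Z = (M * N') * (M * Z) by ring.
by rewrite ler_pM // ltW.
Qed.

Section Commutation.
Variables (R : realType) (b : nat) (beta h : R).
Variables (tau : tree b -> bool) (r : tree b) (m : nat).
Local Notation V := (vertex b m).
Local Notation T := (subtree b m).
Local Notation conf := (conf tau r m).
Local Notation weight := (Defs.weight beta h).
Local Notation E := (condexp beta h).
Implicit Types (A C D : {set V}) (s t eta : conf) (x y : V) (f g u : conf -> R).

Lemma weight_clos A s t : (forall x, x \in clos A -> at_ s x = at_ t x) ->
  weight A s = weight A t.
Proof.
move=> H; rewrite /Defs.weight; congr expR; congr (_ * _); congr (_ + _); last congr (_ * _).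
  by apply: eq_bigr => -[x y] /= /and3P[_ /H -> /H ->].
by apply: eq_bigr => x xA; rewrite H // inE xA.
Qed.

Lemma E_ratio A D f eta : A \subset D ->
  E A f eta = (\sum_(s | agree_off A eta s) weight D s * f s) /
              (\sum_(s | agree_off A eta s) weight D s).
Proof.
move=> AD; rewrite /condexp /expect (bigID (agree_off A eta)) /= [X in _ + X]big1 ?addr0.
  by rewrite mulr_suml; apply: eq_bigr => s es; rewrite (muE _ _ AD) // mulrAC.
by move=> s es; rewrite mu_off ?mul0r.
Qed.

(** No spin of C varies inside a class, so [patch C t] maps the class of s bijectively onto that of
    [patch C t s], with inverse [patch C s]. *)
Lemma class_patch A C t s (F : conf -> R) : [disjoint C & A] ->
  \sum_(s' | agree_off A (patch C t s) s') F s' =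
  \sum_(s' | agree_off A s s') F (patch C t s').
Proof.
move=> dCA; have CA x : x \in C -> x \notin A by move/(disjointFr dCA)=> ->.
rewrite (reindex_onto (patch C t) (patch C s)) /=.
  apply: eq_bigl => s'; apply/andP/agree_offP => [[/agree_offP H /eqP <-] x xA|H].
    have := H x xA; rewrite !at_patch; by case: ifP.
  split.
    by apply/agree_offP => x xA; rewrite !at_patch; case: ifP => // _; rewrite H.
  apply/eqP/conf_ext => x; rewrite !at_patch.
  by case: (boolP (x \in C)) => // xC; rewrite H ?CA.
move=> s' /agree_offP H; apply: conf_ext => x; rewrite !at_patch.
by case: (boolP (x \in C)) => // xC; rewrite H ?CA // at_patch xC.
Qed.

(** Spatial Markov property: no spin of C enters [weight A]. *)
Lemma E_patch_eq A C t s f : separated C A ->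
  E A (fun s' => f (patch C t s')) s = E A f (patch C t s).
Proof.
move=> sep; rewrite !(E_ratio _ _ (subxx A)) !class_patch ?separated_disjoint //.
have W s' : weight A (patch C t s') = weight A s'.
  apply: weight_clos => x xA; rewrite at_patch.
  by case: ifP => // /(disjointFr sep); rewrite xA.
by congr (_ / _); apply: eq_bigr => s' _; rewrite W.
Qed.

(** Changing the spins of C costs a factor M in the weighted sum and another one in the
    normalization. *)
Lemma E_patch_comp A D C t s (M : R) u : A \subset D -> [disjoint C & A] ->
  0 <= M -> (forall s', 0 <= u s') ->
  (forall s', agree_off A s s' -> weight D (patch C t s') <= M * weight D s') ->
  (forall s', agree_off A s s' -> weight D s' <= M * weight D (patch C t s')) ->
  E A (fun s' => u (patch C t s')) s <= M ^+ 2 * E A u (patch C t s) /\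
  E A u (patch C t s) <= M ^+ 2 * E A (fun s' => u (patch C t s')) s.
Proof.
move=> AD dCA M0 u0 H1 H2; rewrite !(E_ratio _ _ AD) !class_patch //.
have Zpos (F : conf -> conf) : 0 < \sum_(s' | agree_off A s s') weight D (F s').
  rewrite (bigD1 s) ?agree_refl //=; apply: ltr_wpDr (weight_gt0 _ _ _ _).
  by apply: sumr_ge0 => *; exact/ltW/weight_gt0.
have Z1 := Zpos id; have Z2 := Zpos (patch C t).
have W0 (F : conf -> conf) (G : conf -> R) : (forall s', 0 <= G s') ->
    0 <= \sum_(s' | agree_off A s s') weight D (F s') * G s'.
  by move=> G0; apply: sumr_ge0 => s' _; rewrite mulr_ge0 // ltW ?weight_gt0.
split; apply: ratio_le => //.
- exact: (W0 id).
- by rewrite mulr_sumr; apply: ler_sum => s' /H2 ?; rewrite mulrA ler_wpM2r.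
- by rewrite mulr_sumr; apply: ler_sum => s' /H1.
- exact: W0.
- by rewrite mulr_sumr; apply: ler_sum => s' /H1 ?; rewrite mulrA ler_wpM2r.
- by rewrite mulr_sumr; apply: ler_sum => s' /H2.
Qed.

(** By the Markov property the inner measure can be frozen at eta, so that the iterated mean becomes
    a double sum over a product measure, symmetric in A and C. *)
Lemma E_iter A C f eta : separated A C ->
  E A (E C f) eta = E A (fun s => E C (fun t => f (patch A s t)) eta) eta.
Proof.
by move=> sep; apply: E_eq => s es; rewrite E_patch_eq // patchK.
Qed.

Lemma E_comm A C f : separated A C -> E A (E C f) = E C (E A f).
Proof.
move=> sep; have sep' := separated_sym sep.
apply: funext => eta; rewrite !E_iter // /condexp /expect.
under eq_bigr do rewrite mulr_sumr; under [RHS]eq_bigr do rewrite mulr_sumr.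
rewrite exchange_big /=; apply: eq_bigr => t _; apply: eq_bigr => s _.
rewrite mulrCA; case: (boolP (agree_off A eta s)) => [/agree_offP es|es]; last first.
  by rewrite (mu_off _ _ es) !(mul0r, mulr0).
case: (boolP (agree_off C eta t)) => [/agree_offP et|et]; last first.
  by rewrite (mu_off _ _ et) !(mul0r, mulr0).
congr (_ * (_ * f _)); apply: conf_ext => x; rewrite !at_patch.
case: ifPn => xA; first by rewrite (disjointFr (separated_disjoint sep)).
by case: ifPn => // xC; rewrite es ?et.
Qed.

(** By the tower property it suffices that [E A (E C f)] depends on no spin of either set: the spins
    of A are changed first, then those of C after commuting. *)
Lemma E_sepU A C f : separated A C -> E (A :|: C) f = E A (E C f).
Proof.
move=> sep; rewrite -(E_tower _ _ f (subsetUr A C)).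
rewrite -(E_tower _ _ (E C f) (subsetUl A C)); apply: E_id => s t st.
have st1 : agree_off A s (patch A t s) by exact: patch_agree.
have st2 : agree_off C (patch A t s) t.
  apply/agree_offP => x xC; rewrite at_patch; case: ifPn => // xA.
  by rewrite (agree_offP _ _ _ st) // inE negb_or xA.
rewrite (E_indep _ _ _ st1) E_comm //; exact: E_indep st2.
Qed.

Lemma E_set0 f : E set0 f = f.
Proof.
apply: E_id => s t /agree_offP st; congr f; apply: conf_ext => x.
by rewrite st // inE.
Qed.

End Commutation.

(** * Squared norms and orthogonality *)

Section SquareNorm.
Variables (R : realType) (b : nat) (beta h : R).
Variables (tau : tree b -> bool) (r : tree b) (m : nat).
Local Notation V := (vertex b m).
Local Notation conf := (conf tau r m).
Local Notation E := (condexp beta h).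
Variables (D : {set V}) (eta : conf).
Implicit Types (A C : {set V}) (f g : conf -> R).

Definition sqnorm f : R := E D (fun s => f s ^+ 2) eta.

Lemma sqnorm_ge0 f : 0 <= sqnorm f.
Proof. by apply: E_ge0 => s _; exact: sqr_ge0. Qed.

(** Self-adjointness and idempotence of [E A] make [f - E A f] orthogonal to [E A f]. *)
Lemma sqnorm_pyth A f : A \subset D ->
  sqnorm (fun s => f s - E A f s) = sqnorm f - sqnorm (E A f).
Proof.
move=> AD; rewrite /sqnorm.
have -> : (fun s => (f s - E A f s) ^+ 2) =
   (fun s => (f s ^+ 2 - 2 * (E A f s * f s)) + E A f s ^+ 2).
  by apply: funext => s; ring.
have e1 : E D (fun s => E A f s * f s) eta = E D (fun s => f s * E A f s) eta.
  exact: E_selfadj.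
have e2 : E D (fun s => E A f s ^+ 2) eta = E D (fun s => f s * E A f s) eta.
  rewrite -[in RHS](E_id beta h (E_indep beta h f (A:=A))) -E_selfadj //.
rewrite E_add E_sub E_scale /= e1 e2; ring.
Qed.

Lemma sqnorm_pyth2 A C f : A \subset C -> C \subset D ->
  sqnorm (fun s => E A f s - E C f s) = sqnorm (E A f) - sqnorm (E C f).
Proof.
by move=> sAC CD; have := sqnorm_pyth (E A f) CD; rewrite (E_tower _ _ _ sAC).
Qed.

Lemma sqnorm_E_le A f : A \subset D -> sqnorm (E A f) <= sqnorm f.
Proof. by move=> AD; rewrite -subr_ge0 -sqnorm_pyth ?sqnorm_ge0. Qed.

Lemma sqnorm_mono A C f : A \subset C -> C \subset D ->
  sqnorm (E C f) <= sqnorm (E A f).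
Proof. by move=> sAC CD; rewrite -subr_ge0 -sqnorm_pyth2 // sqnorm_ge0. Qed.

Lemma sqnormD_le f g :
  sqnorm (fun s => f s + g s) <= 2 * sqnorm f + 2 * sqnorm g.
Proof.
rewrite /sqnorm -(mulrDr 2 (E D _ eta)).
have -> : forall f1 f2, E D f1 eta + E D f2 eta = E D (fun s => f1 s + f2 s) eta.
  by move=> f1 f2; rewrite E_add.
have -> : forall f1, 2 * E D f1 eta = E D (fun s => 2 * f1 s) eta.
  by move=> f1; rewrite E_scale.
apply: E_le => s _; rewrite -subr_ge0.
have -> : 2 * (f s ^+ 2 + g s ^+ 2) - (f s + g s) ^+ 2 = (f s - g s) ^+ 2 by ring.
exact: sqr_ge0.
Qed.

(** Turns averaged conditional variances into differences of squared norms, the form in which they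
    are compared below. *)
Lemma E_variance A f : A \subset D ->
  E D (fun s => variance beta h A s f) eta = sqnorm f - sqnorm (E A f).
Proof.
move=> AD; rewrite -sqnorm_pyth // /sqnorm -(E_tower _ _ (fun s => (_ - _) ^+ 2) AD).
by apply: E_eq => s _; rewrite varianceE.
Qed.

Lemma variance_sqnorm f : variance beta h D eta f = sqnorm f - sqnorm (E D f).
Proof.
rewrite varianceE -sqnorm_pyth //.
Qed.

(** By commutation the left side is the squared norm of [E C] applied to [f - E A f], and [E C] is a
    contraction. *)
Lemma sqnorm_comm A C f : A \subset D -> C \subset D -> separated A C ->
  sqnorm (E C f) - sqnorm (E A (E C f)) <= sqnorm f - sqnorm (E A f).
Proof.
move=> AD CD sep; rewrite -!sqnorm_pyth // E_comm //.
have -> : (fun s => E C f s - E C (E A f) s) = E C (fun s => f s - E A f s).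
  by rewrite E_sub.
exact: sqnorm_E_le.
Qed.

End SquareNorm.

(** * Geometry of the tree *)

Section Tree.
Variables (b m : nat).
Local Notation V := (vertex b m).
Local Notation T := (subtree b m).
Implicit Types (x y z : V) (A C : {set V}).

Lemma prefix_size x y : prefix x y -> (size x <= size y)%N.
Proof. exact: size_prefix. Qed.

Lemma belowP x y : reflect ((size y <= m)%N /\ prefix x y) (y \in below x).
Proof. by rewrite !inE; exact: andP. Qed.

Lemma below_sub x : below x \subset T.
Proof. by apply/subsetP => y; rewrite !inE => /andP[]. Qed.

Lemma below_refl x : x \in T -> x \in below x.
Proof. by rewrite !inE => ->; exact: prefix_refl. Qed.

Lemma below_trans x y : y \in below x -> below y \subset below x.
Proof.
case/belowP=> ym xy; apply/subsetP => z /belowP[zm yz].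
by apply/belowP; split=> //; exact: prefix_trans yz.
Qed.

Lemma childP x y : reflect (exists i, (y : seq 'I_b) = rcons x i) (child x y).
Proof. by apply: (iffP existsP) => -[i /eqP H]; exists i => //; apply/eqP. Qed.

Lemma size_child x y : child x y -> size y = (size x).+1.
Proof. by case/childP=> i ->; rewrite size_rcons. Qed.

Lemma child_below x y z : child y z -> y \in below x -> z \in T -> z \in below x.
Proof.
case/childP=> i zE /belowP[ym xy]; rewrite inE => zm.
by apply/belowP; split=> //; rewrite zE (prefix_trans xy) // prefix_rcons.
Qed.

Lemma parent_below x y z : child z y -> y \in below x -> y = x \/ z \in below x.
Proof.
move=> zy; have sy := size_child zy; case/childP: (zy) => i yE.
case/belowP=> ym xy; move: (xy); rewrite yE prefixE => /eqP xE.
have sxy : (size x <= (size z).+1)%N by rewrite -sy; exact: size_prefix.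
case: (ltnP (size z) (size x)) => szx; [left|right].
  apply/val_inj => /=; rewrite yE -xE take_oversize //.
  by rewrite size_rcons.
apply/belowP; split; first by apply: leq_trans ym; rewrite sy.
by rewrite prefixE -{2}xE -cats1 takel_cat.
Qed.

Lemma below_prefix_eq x y : prefix x y -> (size y <= size x)%N -> y = x.
Proof.
rewrite prefixE => /eqP xE sz; apply/val_inj => /=; rewrite -xE.
by rewrite take_oversize.
Qed.

Lemma child_parent_uniq x y z : child x z -> child y z -> x = y.
Proof.
case/childP=> i zE /childP[j]; rewrite zE => /rcons_inj[xy _].
exact: val_inj.
Qed.

Lemma not_separatedP A C : reflect (exists x y, [/\ x \in A, y \in C &
   (x == y) || adj x y]) (~~ separated A C).
Proof.
rewrite /separated; apply: (iffP pred0Pn) => [[x /=]|[x [y [xA yC]]]].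
  rewrite !inE => /andP[xA /orP[xC|/andP[_ /existsP[y /andP[yC yx]]]]].
    by exists x, x; rewrite eqxx.
  by exists x, y; split=> //; rewrite /adj [child x y || _]orbC [X in _ || X]yx orbT.
rewrite orbC; case: (boolP (x \in C)) => [xC _|xC].
  by exists x; rewrite /= xA !inE xC.
case/orP=> [xy|/eqP xy]; last by rewrite xy yC in xC.
exists x; rewrite /= xA !inE (negbTE xC) /=; apply/existsP; exists y.
by rewrite yC /adj orbC.
Qed.

Lemma separatedI A C : (forall x y, x \in A -> y \in C -> x != y /\ ~~ adj x y) ->
  separated A C.
Proof.
move=> H; apply/negPn/not_separatedP => -[x [y [xA yC]]].
by case: (H x y xA yC) => /negbTE -> /negbTE ->.
Qed.

(** The only edge of T leaving [below x] joins x to its parent, which the last hypothesis keeps out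
    of C. *)
Lemma separated_below x C : C \subset T -> [disjoint C & below x] ->
  (forall z, z \in C -> ~~ child z x) -> separated (below x) C.
Proof.
move=> /subsetP CT dC pC; apply: separatedI => y z yx zC.
have zx : z \notin below x by rewrite (disjointFr dC zC).
split; first by apply: contraNneq zx => <-.
rewrite /adj negb_or; apply/andP; split.
  by apply: contra zx => yz; exact: child_below yz yx (CT _ zC).
apply/negP => zy; case: (parent_below zy yx) => [yE|]; last exact/negP.
by move: (pC _ zC); rewrite -yE zy.
Qed.

End Tree.

(** * Peeling vertices off the top of the tree *)

Section TreeDecomposition.
Variables (R : realType) (b : nat) (beta h : R).
Variables (tau : tree b -> bool) (r : tree b) (m : nat).
Local Notation V := (vertex b m).
Local Notation T := (subtree b m).
Local Notation conf := (conf tau r m).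
Local Notation E := (condexp beta h).
Variables (eta : conf).
Local Notation N := (sqnorm beta h T eta).
Implicit Types (A C : {set V}) (x y z : V) (f g : conf -> R).

(* mu[Var_{T_x}(mu_{T_x \ x}(f))] *)
Definition root_var x f : R := N (E (sbelow x) f) - N (E (below x) f).

Lemma sbelow_sub x : sbelow x \subset below x.
Proof. exact: subD1set. Qed.

Lemma root_var_ge0 x f : 0 <= root_var x f.
Proof. by rewrite subr_ge0 sqnorm_mono ?sbelow_sub ?below_sub. Qed.

Lemma root_var_avg x C f : C \subset T -> separated (below x) C ->
  root_var x (E C f) <= root_var x f.
Proof.
move=> CT sep; rewrite /root_var (E_comm _ _ _ (separatedS (sbelow_sub x) sep)).
rewrite -(E_tower _ _ (E C f) (sbelow_sub x)) (E_comm _ _ _ (separatedS (sbelow_sub x) sep)).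
rewrite -[in X in _ <= X](E_tower _ _ f (sbelow_sub x)).
by apply: sqnorm_comm; rewrite ?below_sub.
Qed.

(** Induction on the size of A, removing one topmost vertex x. The part C of A outside T_x is
    separated from T_x, so passing from [E (A :\ x) f] to [E A f] is passing from [E (sbelow x) f]
    to [E (below x) f] after averaging over C; by [sqnorm_comm] this loses at most
    [root_var x f]. *)
Lemma var_le_root_var A f : A \subset T ->
  (forall x y, x \in A -> y \in below x -> y \in A) ->
  N f - N (E A f) <= \sum_(y in A) root_var y f.
Proof.
have [n] := ubnP #|A|; elim: n A => // n IH A; rewrite ltnS => cA AT clA.
case: (set_0Vmem A) => [->|[x0 x0A]].
  by rewrite big_set0 E_set0 subrr.
(* Least depth keeps [A :\ x] closed under descendants and the parent of x out of A. *)
case: (arg_minnP (P := [in A]) (fun x => size x) x0A) => x xA minx.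
have AT' : A :\ x \subset T by apply: subset_trans AT; exact: subD1set.
have cl' y z : y \in A :\ x -> z \in below y -> z \in A :\ x.
  rewrite !in_setD1 => /andP[yx yA] zy; rewrite (clA _ _ yA zy) andbT.
  apply: contraNneq yx => zx; case/belowP: zy => _; rewrite zx => yx.
  by rewrite -(below_prefix_eq yx) ?minx.
have xx : x \in below x by apply/below_refl/(subsetP AT).
pose C := A :\: below x.
have bxA : below x \subset A by apply/subsetP => y; exact: clA.
have sep : separated (below x) C.
  apply: separated_below.
  - by apply: subset_trans AT; exact: subsetDl.
  - by rewrite disjoint_sym -setI_eq0 setIDA setDIl setDv set0I.
  - move=> z; rewrite inE => /andP[_ zA]; apply/negP => /size_child sz.
    by have := minx _ zA; rewrite sz ltnn.
have CT : C \subset T by apply: subset_trans AT; exact: subsetDl.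
have A1 : A = below x :|: C.
  apply/setP => y; rewrite in_setU in_setD.
  by case: (boolP (y \in below x)) => [/(subsetP bxA) ->|].
have A2 : A :\ x = sbelow x :|: C.
  apply/setP => y; have : (y \in A) = (y \in below x :|: C) by rewrite -A1.
  rewrite in_setU => yA; rewrite [RHS]in_setU !in_setD1 yA.
  by case: eqP => //= ->; rewrite in_setD xx.
have -> : \sum_(y in A) root_var y f =
    root_var x f + \sum_(y in A :\ x) root_var y f.
  by rewrite (bigD1 x) //=; congr (_ + _); apply: eq_bigl => y; rewrite in_setD1 andbC.
rewrite (cardsD1 x A) xA in cA; have IHx := IH _ cA AT' cl'.
have := sqnorm_comm beta h eta (E (sbelow x) f) (below_sub x) CT sep.
have -> : E (below x) (E C (E (sbelow x) f)) = E A f.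
  by rewrite A1 E_sepU // !(E_comm _ _ _ sep) (E_tower _ _ f (sbelow_sub x)).
have -> : E C (E (sbelow x) f) = E (A :\ x) f.
  have sep' := separatedS (sbelow_sub x) sep.
  by rewrite A2 E_sepU // (E_comm _ _ _ sep').
rewrite E_tower ?sbelow_sub // -/(root_var x f).
by move: IHx; lra.
Qed.

End TreeDecomposition.

(* Simplification is needed because [size] occurs at different but convertible
   presentations of the type of letters. *)
Ltac size_lia := simpl in *; lia.

(** Ancestors of y are prefixes of y, hence determined by their lengths, and only l lengths are
    admissible. *)
Lemma card_ancestors (b m : nat) (y : vertex b m) (a l : nat) :
  (#|[set x : vertex b m | prefix x y & (a + size x <= size y < a + l + size x)%N]|
     <= l)%N.
Proof.
set S := [set x | _].
have inj : {in enum S &, injective (fun x : vertex b m => (size y - size x)%N)}.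
  move=> x z; rewrite !mem_enum !inE => /andP[xy _] /andP[zy _] /= e.
  have sx := prefix_size xy; have sz := prefix_size zy.
  have {}e : size x = size z by size_lia.
  by apply/val_inj; move: xy zy; rewrite !prefixE /= => /eqP <- /eqP <-; rewrite e.
rewrite cardE -(size_map (fun x : vertex b m => (size y - size x)%N)) -[leqRHS](size_iota a).
apply: uniq_leq_size; first by rewrite map_inj_in_uniq ?enum_uniq.
move=> k /mapP[x]; rewrite mem_enum !inE => /andP[_ H] ->.
by rewrite mem_iota; size_lia.
Qed.

(** After exchanging the sums, each y is counted once per admissible ancestor. The offset [a = 1]
    serves descendants at distance 1 to l, and [a = 0] serves blocks. *)
Lemma sum_ancestors (R : realType) (b m : nat) (a l : nat)
    (F : vertex b m -> R) (Q : rel (vertex b m)) :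
  (forall y, 0 <= F y) ->
  (forall x y, Q x y ->
     [/\ prefix x y, (size y <= m)%N & (a + size x <= size y < a + l + size x)%N]) ->
  \sum_(x in subtree b m) \sum_(y | Q x y) F y <= l%:R * \sum_(y in subtree b m) F y.
Proof.
move=> F0 HQ.
rewrite (exchange_big_dep (mem (subtree b m))) /=; last first.
  by move=> x y _ /HQ[_ ym _]; rewrite inE.
rewrite mulr_sumr; apply: ler_sum => y _.
rewrite sumr_const -[leLHS]mulr_natl ler_wpM2r ?F0 // ler_nat.
apply: leq_trans (card_ancestors y a l); apply: subset_leq_card.
apply/subsetP => x; rewrite unfold_in /= => /andP[_ /HQ[xy _ s]].
by rewrite inE xy.
Qed.

(** * The block inequality of part (a) *)

Section BlockBound.
Variables (R : realType) (b : nat) (beta h : R).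
Variables (tau : tree b -> bool) (r : tree b) (m : nat).
Local Notation V := (vertex b m).
Local Notation T := (subtree b m).
Local Notation conf := (conf tau r m).
Local Notation E := (condexp beta h).
Variables (eta : conf).
Local Notation N := (sqnorm beta h T eta).
Local Notation P := (root_var beta h eta).
Implicit Types (A C : {set V}) (x y z : V) (f g : conf -> R).

Lemma block_sub x l : block x l \subset below x.
Proof. by apply/subsetP => y; rewrite inE => /andP[]. Qed.

Lemma VM_root_var l eps x f : VM beta h tau r m l eps -> x \in T ->
  indep_of (block x l) f -> P x f <= eps * (N f - N (E (below x) f)).
Proof.
move=> vm xT indf.
have := E_variance beta h eta (E (sbelow x) f) (below_sub x).
rewrite (E_tower _ _ f (sbelow_sub x)) -/(root_var _ _ _ _ _) => <-.
rewrite -E_variance ?below_sub //.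
rewrite -[eps * _]/(eps * (fun s => E T (fun s => variance beta h (below x) s f) s) eta).
have -> : eps * E T (fun s => variance beta h (below x) s f) eta =
          E T (fun s => eps * variance beta h (below x) s f) eta.
  by rewrite E_scale.
by apply: E_le => s _; exact: vm.
Qed.

Lemma root_var_le l eps x f : VM beta h tau r m l eps -> 0 <= eps <= 1 -> x \in T ->
  (1 - 2 * eps) * P x f <= (2 - 2 * eps) * (N f - N (E (block x l) f))
    + 2 * eps * \sum_(y in sbelow x | (size y <= size x + l)%N) P y f.
Proof.
move=> vm /andP[eps0 eps1] xT.
(* The level at distance exactly l belongs to neither set and separates them. *)
pose B := block x l; pose C := [set y in below x | (size x + l < size y)%N].
have CT : C \subset T.
  by apply: subset_trans (below_sub x); apply/subsetP => y; rewrite inE => /andP[].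
have BT : B \subset T by apply: subset_trans (block_sub _ _) (below_sub x).
have Cb : C \subset sbelow x.
  apply/subsetP => y; rewrite inE in_setD1 => /andP[-> H]; rewrite andbT.
  by apply: contraTneq H => ->; size_lia.
have sepBC : separated B C.
  apply: separatedI => y z; rewrite !inE => /andP[_ sy] /andP[_ sz]; split.
    by apply: contraTneq sz => <-; size_lia.
  by rewrite /adj negb_or; apply/andP; split; apply/negP => /size_child; size_lia.
pose g := E C f.
have sbT : sbelow x \subset T by apply: subset_trans (sbelow_sub x) (below_sub x).
have Pg : P x g = P x f.
  rewrite /root_var /g E_tower // E_tower //.
  exact: subset_trans Cb (sbelow_sub x).
have bg : N g - N (E B g) <= N f - N (E B f) by exact: sqnorm_comm.
(* Peeling T_x without x gives the terms [P y g]. They vanish at distance more than l, where T_y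
   lies in C and g ignores its spins. At distance at most l, the part of C inside T_y does not
   affect [P y], and averaging over the part outside T_y can only decrease it. *)
have Wg : N g - N (E (sbelow x) g) <=
    \sum_(y in sbelow x | (size y <= size x + l)%N) P y f.
  apply: le_trans (var_le_root_var beta h eta g sbT _) _.
    move=> y z; rewrite !in_setD1 => /andP[yx yb] zy.
    rewrite (subsetP (below_trans yb)) // andbT.
    apply: contraNneq yx => zx; case/belowP: zy; rewrite zx => _ yx.
    by case/belowP: yb => _ /prefix_size sxy; rewrite -(below_prefix_eq yx).
  rewrite (bigID (fun y : V => (size y <= size x + l)%N)) /=.
  rewrite [X in _ + X]big1 ?addr0 => [|y /andP[yx]]; last first.
    rewrite -ltnNge => sy; rewrite /root_var /g.
    have yC : below y \subset C.
      move: yx; rewrite in_setD1 => /andP[_ yx].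
      apply/subsetP => z zy; rewrite inE (subsetP (below_trans yx)) //=.
      by case/belowP: zy => _ /prefix_size; apply: leq_trans.
    by rewrite !E_tower_in ?subrr // (subset_trans (sbelow_sub y)).
  apply: ler_sum => y /andP[yx sy].
  have byx : below y \subset below x.
    by apply: below_trans; move: yx; rewrite in_setD1 => /andP[].
  pose C1 := C :&: below y; pose C2 := C :\: below y.
  have sep2 : separated (below y) C2.
    apply: separated_below.
    - by apply: subset_trans CT; exact: subsetDl.
    - by rewrite disjoint_sym -setI_eq0 setIDA setDIl setDv set0I.
    - move=> z; rewrite !inE => /andP[_ /andP[_ sz]].
      by apply/negP => /size_child; size_lia.
  have C1y : C1 \subset sbelow y.
    apply/subsetP => z; rewrite !in_setI in_setD1 inE => /andP[/andP[_ sz] ->].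
    by rewrite andbT; apply: contraTneq sz => ->; size_lia.
  have -> : P y g = P y (E C2 f).
    have gE : g = E C1 (E C2 f).
      rewrite -E_sepU; last by apply: separatedS sep2; exact: subsetIr.
      by rewrite setID.
    rewrite /root_var gE (E_tower _ _ (E C2 f) C1y).
    by rewrite (E_tower _ _ (E C2 f) (subset_trans C1y (sbelow_sub y))).
  apply: root_var_avg => //.
  by apply: subset_trans CT; exact: subsetDl.
have PB : P x (E B g) <= eps * (N (E B g) - N (E (below x) (E B g))).
  by apply: VM_root_var vm xT _; exact: E_indep.
have Ebg : E (below x) (E B g) = E (below x) g by rewrite E_tower ?block_sub.
(* Splits g into [g - E B g] and [E B g]; the square of a sum costs the factors 2. *)
have V1 : P x g <= 2 * (N g - N (E B g)) + 2 * P x (E B g).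
  rewrite /root_var -!sqnorm_pyth2 ?sbelow_sub ?below_sub //.
  rewrite -sqnorm_pyth //.
  apply: (@le_trans _ _ (2 * N (fun s => E (sbelow x) (fun s => g s - E B g s) s
     - E (below x) (fun s => g s - E B g s) s)
     + 2 * N (fun s => E (sbelow x) (E B g) s - E (below x) (E B g) s))).
    have -> : (fun s => E (sbelow x) g s - E (below x) g s) = (fun s =>
      (E (sbelow x) (fun s => g s - E B g s) s - E (below x) (fun s => g s - E B g s) s)
       + (E (sbelow x) (E B g) s - E (below x) (E B g) s)).
      by apply: funext => s; rewrite !E_sub; ring.
    exact: sqnormD_le.
  rewrite lerD2r ler_wpM2l // sqnorm_pyth2 ?sbelow_sub ?below_sub //.
  have := sqnorm_E_le beta h eta (fun s => g s - E B g s) sbT.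
  have := sqnorm_ge0 beta h T eta (E (below x) (fun s => g s - E B g s)).
  lra.
have PgE : P x g = N (E (sbelow x) g) - N (E (below x) g) by [].
rewrite Ebg in PB; rewrite -Pg.
set W := \sum_(y in _ | _) _ in Wg *.
have ne : eps * (N g - N (E (sbelow x) g)) <= eps * W by rewrite ler_wpM2l.
(* The last difference equals [P x g], plus the variance bounded by W, minus the block variance of
   g. Moving the [P x g] term to the left gives the coefficients [1 - 2 * eps] and [2 - 2 * eps]. *)
have N1 : P x g <= 2 * (N g - N (E B g)) + 2 * eps * (N (E B g) - N (E (below x) g)) by lra.
have e2 : 0 <= (2 - 2 * eps) * ((N f - N (E B f)) - (N g - N (E B g))).
  by rewrite mulr_ge0 ?subr_ge0 //; lra.
move: ne N1 e2; rewrite PgE; lra.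
Qed.

Lemma var_le_dirichlet_block (l : nat) (delta : R) f :
  (1 <= l)%N -> 0 < delta -> delta <= 1 ->
  VM beta h tau r m l ((1 - delta) / (2 * (l%:R + 1 - delta))) ->
  N f - N (E T f) <= 3 / delta * \sum_(x in T) (N f - N (E (block x l) f)).
Proof.
move=> l1 d0 d1 vm; set eps := _ / _ in vm.
have L1 : 1 <= l%:R :> R by rewrite ler1n.
have Lp : 0 < l%:R + 1 - delta by lra.
have epsE : eps * (2 * (l%:R + 1 - delta)) = 1 - delta.
  by rewrite /eps divfK //; apply: lt0r_neq0; lra.
have eps01 : 0 <= eps <= 1.
  rewrite /eps divr_ge0 ?ler_pdivrMr //=; lra.
set D := \sum_(x in T) _.
have D0 : 0 <= D.
  apply: sumr_ge0 => x _; rewrite subr_ge0 sqnorm_E_le //.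
  by apply: subset_trans (block_sub x l) (below_sub x).
pose S := \sum_(x in T) P x f.
have S1 : (1 - 2 * eps) * S <= (2 - 2 * eps) * D + 2 * eps * (l%:R * S).
  rewrite /S mulr_sumr.
  apply: le_trans (ler_sum _ (fun x xT => root_var_le f vm eps01 xT)) _.
  rewrite big_split /= -!mulr_sumr lerD2l ler_wpM2l //.
    by rewrite mulr_ge0 //; case/andP: eps01.
  apply: (@sum_ancestors _ _ _ 1 l (fun y => P y f)
    (fun x y => (y \in sbelow x) && (size y <= size x + l)%N)).
    by move=> y; exact: root_var_ge0.
  move=> x y /andP[]; rewrite in_setD1 => /andP[yx /belowP[ym xy]] sy; split=> //.
  have := prefix_size xy; rewrite leq_eqVlt => /orP[/eqP e|]; last by size_lia.
  by rewrite (below_prefix_eq xy) ?eqxx // ?e in yx.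
have VS : N f - N (E T f) <= S.
  apply: var_le_root_var => // x y xT; exact: (subsetP (below_sub x)).
apply: le_trans VS _.
rewrite mulrAC ler_pdivlMr //.
have S2 : (2 * (l%:R + 1 - delta)) * ((1 - 2 * eps) * S) <=
  (2 * (l%:R + 1 - delta)) * ((2 - 2 * eps) * D + 2 * eps * (l%:R * S)).
  by rewrite ler_wpM2l //; lra.
(* For this eps, S2 reads l * delta * S <= (2 * l + 1 - delta) * D up to a common factor 2, and l >=
   1 gives 2 * l + 1 - delta <= 3 * l. *)
have S3 : l%:R * (S * delta) <= l%:R * (3 * D).
  have e1 : (2 * (l%:R + 1 - delta)) * ((1 - 2 * eps) * S) =
    2 * (l%:R + 1 - delta) * S - 2 * (eps * (2 * (l%:R + 1 - delta))) * S by ring.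
  have e2 : (2 * (l%:R + 1 - delta)) * ((2 - 2 * eps) * D + 2 * eps * (l%:R * S)) =
    4 * (l%:R + 1 - delta) * D - 2 * (eps * (2 * (l%:R + 1 - delta))) * D
     + 2 * (eps * (2 * (l%:R + 1 - delta))) * l%:R * S by ring.
  rewrite e1 e2 epsE in S2.
  have H : 0 <= (l%:R - 1 + delta) * D by rewrite mulr_ge0 //; lra.
  lra.
by rewrite -(ler_pM2l (x := l%:R)) //; lra.
Qed.

End BlockBound.

(** * Single-site updates and the spectral gap *)

Lemma card_children (b m : nat) (x : vertex b m) :
  (#|[set y : vertex b m | child x y]| <= b)%N.
Proof.
set S := [set y | _]; pose e := [seq rcons (x : seq 'I_b) i | i : 'I_b].
have se : size e = b by rewrite size_map -cardE card_ord.
rewrite -[leqRHS]se cardE -(size_map (fun y : vertex b m => (y : seq 'I_b))).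
apply: uniq_leq_size.
  by rewrite map_inj_uniq ?enum_uniq //; exact: val_inj.
move=> s /mapP[y]; rewrite mem_enum inE => /childP[i yE] ->.
by apply/mapP; exists i; rewrite ?mem_enum.
Qed.

Lemma card_parents (b m : nat) (x : vertex b m) :
  (#|[set y : vertex b m | child y x]| <= 1)%N.
Proof.
apply/card_le1P => y yx z; rewrite !inE in yx *.
by apply/idP/eqP => [zx|-> //]; exact: child_parent_uniq zx yx.
Qed.

Lemma card_edges (b m : nat) (p : vertex b m) :
  (#|[set q : vertex b m * vertex b m |
      child q.1 q.2 & (q.1 == p) || (q.2 == p)]| <= b.+1)%N.
Proof.
pose S1 := [set y : vertex b m | child p y]; pose S2 := [set y : vertex b m | child y p].
apply: (@leq_trans #|[set (p, y) | y in S1] :|: [set (y, p) | y in S2]|).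
  apply: subset_leq_card; apply/subsetP => -[x y]; rewrite !inE /=.
  case/andP=> xy /orP[/eqP xp|/eqP yp]; apply/orP; [left|right].
    by apply/imsetP; exists y; rewrite ?inE -?xp.
  by apply/imsetP; exists x; rewrite ?inE -?yp.
apply: leq_trans (leq_card_setU _ _) _; rewrite -[leqRHS]addn1.
by apply: leq_add; apply: leq_trans (leq_imset_card _ _) _;
   [exact: card_children|exact: card_parents].
Qed.

(** A vertex of the block is determined by its path from x, a word of length at most l; the bound
    thus depends on neither x nor the depth m. *)
Lemma card_block (b m : nat) (x : vertex b m) l :
  (#|block x l| <= #|{: l.-bseq 'I_b}|)%N.
Proof.
pose e := [seq (s : seq 'I_b) | s : l.-bseq 'I_b].
have se : size e = #|{: l.-bseq 'I_b}| by rewrite size_map -cardE.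
rewrite -[leqRHS]se cardE -(size_map (fun y : vertex b m => drop (size x) y)).
have pre y : y \in block x l -> prefix x y by rewrite !inE => /andP[/andP[]].
apply: uniq_leq_size.
  rewrite map_inj_in_uniq ?enum_uniq // => y z; rewrite !mem_enum => /pre yx /pre zx H.
  apply/val_inj; rewrite /= -(cat_take_drop (size x) y) -(cat_take_drop (size x) z) H.
  by move: yx zx; rewrite !prefixE => /eqP -> /eqP ->.
move=> s /mapP[y]; rewrite mem_enum => yB ->.
have sz : (size (drop (size x) y) <= l)%N.
  by move: yB; rewrite inE size_drop => /andP[_]; size_lia.
by apply/mapP; exists (Bseq sz); rewrite ?mem_enum.
Qed.

Section SingleSite.
Variables (R : realType) (b : nat) (beta h : R).
Variables (tau : tree b -> bool) (r : tree b) (m : nat).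
Local Notation V := (vertex b m).
Local Notation T := (subtree b m).
Local Notation conf := (conf tau r m).
Local Notation weight := (Defs.weight beta h).
Local Notation E := (condexp beta h).
Implicit Types (A C D : {set V}) (x y z p : V) (s t eta : conf) (f g u : conf -> R).

(* A single spin enters at most b + 1 edges and one field term. *)
Definition wratio : R := expR (`|beta| * (2 * (b.+1)%:R + 2 * `|h|)).

Lemma wratio_gt0 : 0 < wratio.
Proof. exact: expR_gt0. Qed.

Lemma weight_le D p s t :
  (forall y, y \in clos D -> y != p -> at_ s y = at_ t y) ->
  weight D s <= wratio * weight D t.
Proof.
move=> H; rewrite /Defs.weight /wratio -expRD ler_expR -lerBlDr -mulrBr.
apply: le_trans (ler_norm _) _; rewrite normrM ler_wpM2l // opprD addrACA.
apply: le_trans (ler_normD _ _) _; apply: lerD.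
  rewrite -sumrB; apply: le_trans (ler_norm_sum _ _ _) _.
  pose Q := [set q : V * V | child q.1 q.2 & (q.1 == p) || (q.2 == p)].
  (* Edges away from p cancel, and each edge at p changes by at most 2. *)
  apply: (@le_trans _ _ (\sum_(q in Q) 2)); last first.
    by rewrite sumr_const -[leLHS]mulr_natr ler_wpM2l // ler_nat card_edges.
  rewrite [leRHS]big_mkcond [leLHS]big_mkcond /=; apply: ler_sum => -[x y] _ /=.
  case: ifPn => [/and3P[xy xD yD]|_]; last by case: ifP.
  rewrite inE /= xy /=; case: ifPn => [_|].
    apply: le_trans (ler_normB _ _) _.
    by rewrite /sgn; do 4![case: (at_ _ _)]; rewrite ?(mulr1, mul1r, mulN1r, opprK, normrN, normr1).
  by rewrite negb_or => /andP[xp yp]; rewrite !H // subrr normr0.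
rewrite -mulrBr normrM mulrC ler_wpM2r // -sumrB.
have Hx x : x \in D -> x != p -> sgn R (at_ s x) - sgn R (at_ t x) = 0.
  by move=> xD xp; rewrite H ?subrr // inE xD.
case: (boolP (p \in D)) => pD; last first.
  rewrite big1 ?normr0 // => x xD; apply: Hx => //.
  by apply: contraNneq pD => <-.
rewrite (bigD1 p) //= big1 ?addr0 => [|x /andP[xD xp]]; last exact: Hx.
apply: le_trans (ler_normB _ _) _.
by rewrite /sgn; do 2![case: (at_ _ _)]; rewrite ?(normrN, normr1).
Qed.

(** A lower bound for single-spin conditional probabilities: at most two configurations compete,
    with weights within a factor [wratio] of each other. *)
Definition pmin : R := (2 * wratio)^-1.

Lemma pmin_gt0 : 0 < pmin.
Proof. by rewrite invr_gt0 mulr_gt0 // wratio_gt0. Qed.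

Lemma card_site_class x eta : (#|[pred t : conf | agree_off [set x] eta t]| <= 2)%N.
Proof.
rewrite -card_bool -(@card_in_image _ _ (fun t : conf => at_ t x)); first exact: max_card.
move=> s t; rewrite !inE => /agree_offP es /agree_offP et e.
apply: conf_ext => y; case: (eqVneq y x) => [-> //|yx].
by rewrite es ?et // inE.
Qed.

Lemma mu_site_ge x eta s : agree_off [set x] eta s -> pmin <= mu beta h [set x] eta s.
Proof.
move=> es; rewrite (muE _ _ (subxx _) es) ler_pdivlMr; last first.
  exact: partition_gt0.
rewrite /pmin mulrC ler_pdivrMr ?mulr_gt0 ?wratio_gt0 //.
apply: (@le_trans _ _ (\sum_(t | agree_off [set x] eta t) wratio * weight [set x] s)).
  apply: ler_sum => t et; apply: (@weight_le _ x) => y _ yx.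
  by rewrite (agree_offP _ _ _ es) ?(agree_offP _ _ _ et) // inE.
rewrite sumr_const -[leLHS]mulr_natr.
have -> : weight [set x] s * (2 * wratio) = wratio * weight [set x] s * 2%:R by ring.
apply: ler_wpM2l.
  by apply: mulr_ge0; apply: ltW; [exact: wratio_gt0|exact: weight_gt0].
rewrite ler_nat; apply: leq_trans (card_site_class x eta).
exact/eq_leq/eq_card.
Qed.

Lemma E_site_ge x u eta s : (forall t, 0 <= u t) -> agree_off [set x] eta s ->
  pmin * u s <= E [set x] u eta.
Proof.
move=> u0 es; rewrite /condexp /expect (bigD1 s) //=.
apply: ler_wpDr; last by rewrite ler_wpM2r ?mu_site_ge.
by apply: sumr_ge0 => t _; rewrite mulr_ge0 ?mu_ge0.
Qed.

Lemma E_site_indep_ge A x u eta s : (forall t, 0 <= u t) -> indep_of A u ->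
  agree_off (x |: A) eta s -> pmin * u s <= E [set x] u eta.
Proof.
move=> u0 iu es; have -> : u s = u (patch [set x] s eta).
  apply: iu; apply/agree_offP => y yA; rewrite at_patch; case: ifPn => // yx.
  by rewrite (agree_offP _ _ _ es) // inE negb_or yx.
apply: E_site_ge => //; exact: patch_agree.
Qed.

Lemma variance_le_sqdist A g eta c :
  variance beta h A eta g <= E A (fun s => (g s - c) ^+ 2) eta.
Proof.
have -> : E A (fun s => (g s - c) ^+ 2) eta =
          E A (fun s => g s ^+ 2 + (- 2 * c * g s + c ^+ 2)) eta.
  by congr (E A _ eta); apply: funext => s; ring.
rewrite !E_add E_scale E_const /variance -!/(condexp _ _ _ _ _) /=.
rewrite -subr_ge0.
have -> : forall a e : R, a + (- 2 * c * e + c ^+ 2) - (a - e ^+ 2) = (e - c) ^+ 2.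
  by move=> a e; ring.
exact: sqr_ge0.
Qed.

(** Given the spins off [x |: A], g is a function of the spin at x, and resampling x alone reaches
    each of its values with probability at least [pmin]. The variance is first replaced by the mean
    squared distance to the fixed number c, which allows a pointwise comparison. *)
Lemma variance_site A x g eta : indep_of A g ->
  pmin * variance beta h (x |: A) eta g <= variance beta h [set x] eta g.
Proof.
move=> ig; rewrite [leRHS]varianceE; set c := E [set x] g eta.
have -> : E [set x] (fun s => (g s - E [set x] g s) ^+ 2) eta =
          E [set x] (fun s => (g s - c) ^+ 2) eta.
  by apply: E_eq => s es; rewrite /c (E_indep _ _ _ es).
apply: (@le_trans _ _ (pmin * E (x |: A) (fun s => (g s - c) ^+ 2) eta)).
  by apply: ler_wpM2l; [exact: ltW pmin_gt0|exact: variance_le_sqdist].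
set u := fun s => (g s - c) ^+ 2.
rewrite -(E_const beta h (x |: A) (E [set x] u eta) eta).
have -> : pmin * E (x |: A) u eta = E (x |: A) (fun s => pmin * u s) eta.
  by rewrite E_scale.
apply: E_le => s es; apply: E_site_indep_ge es.
- by move=> t; exact: sqr_ge0.
- by move=> t t' /ig; rewrite /u => ->.
Qed.

Section Poincare.
Variables (D : {set V}) (eta : conf).
Local Notation N := (sqnorm beta h D eta).

Lemma sqnorm_site A x g : x |: A \subset D -> indep_of A g ->
  N g - N (E (x |: A) g) <= pmin^-1 * (N g - N (E [set x] g)).
Proof.
move=> AD ig; have xD : [set x] \subset D by apply: subset_trans AD; exact: subsetUl.
rewrite -!E_variance // ler_pdivlMl ?pmin_gt0 //.
have -> : pmin * E D (fun s => variance beta h (x |: A) s g) eta =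
          E D (fun s => pmin * variance beta h (x |: A) s g) eta.
  by rewrite E_scale.
by apply: E_le => s _; exact: variance_site.
Qed.

Definition kblock : R := 1 + 2 * pmin^-1.

Lemma kblock_ge1 : 1 <= kblock.
Proof. by rewrite /kblock lerDl mulr_ge0 // invr_ge0 ltW ?pmin_gt0. Qed.

(** The loss is split at g = [E A f]. By [sqnorm_site] the second half is controlled by the effect
    on g of resampling x, and writing g as [f + (g - f)] bounds that effect by both terms on the
    right. *)
Lemma sqnorm_add_site A x f : x |: A \subset D ->
  N f - N (E (x |: A) f) <= kblock * ((N f - N (E A f)) + (N f - N (E [set x] f))).
Proof.
move=> xAD; have AD : A \subset D by apply: subset_trans xAD; exact: subsetUr.
have xD : [set x] \subset D by apply: subset_trans xAD; exact: subsetUl.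
have := sqnorm_site xAD (E_indep beta h f (A := A)).
rewrite E_tower ?subsetUr // -sqnorm_pyth //.
set g := E A f.
have -> : (fun s => g s - E [set x] g s) = (fun s => (f s - E [set x] f s) +
    ((g s - f s) - E [set x] (fun s => g s - f s) s)).
  by apply: funext => s; rewrite E_sub; ring.
have := sqnormD_le beta h D eta (fun s => f s - E [set x] f s)
  (fun s => (g s - f s) - E [set x] (fun s => g s - f s) s).
rewrite !sqnorm_pyth //.
have -> : N (fun s => g s - f s) = N f - N g.
  rewrite -sqnorm_pyth //; congr (E D _ eta); apply: funext => s; rewrite /g; ring.
have := sqnorm_ge0 beta h D eta (E [set x] (fun s => g s - f s)).
set a := N (E [set x] _); set c := N _ => a0 H1 H2.
have p0 : 0 <= pmin^-1 by rewrite invr_ge0 ltW ?pmin_gt0.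
have H3 : pmin^-1 * c <= pmin^-1 * (2 * (N f - N (E [set x] f)) + 2 * (N f - N g)).
  by rewrite ler_wpM2l //; lra.
have H4 : 0 <= N f - N (E [set x] f) by rewrite subr_ge0 sqnorm_E_le.
rewrite /kblock -/g; lra.
Qed.

Lemma sqnorm_block A f n : A \subset D -> (#|A| <= n)%N ->
  N f - N (E A f) <= kblock ^+ n * \sum_(y in A) (N f - N (E [set y] f)).
Proof.
have k1 := kblock_ge1; have k0 : 0 <= kblock by apply: le_trans k1.
elim: n A => [|n IH] A AD cA.
  move: cA; rewrite leqn0 cards_eq0 => /eqP ->.
  by rewrite big_set0 E_set0 subrr mulr0.
case: (set_0Vmem A) => [->|[x xA]]; first by rewrite big_set0 E_set0 subrr mulr0.
have AD' : A :\ x \subset D by apply: subset_trans AD; exact: subD1set.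
have cA' : (#|A :\ x| <= n)%N by rewrite (cardsD1 x) xA in cA.
have xAD : x |: (A :\ x) \subset D by rewrite setD1K.
have xD : [set x] \subset D by rewrite sub1set (subsetP AD).
have := sqnorm_add_site f xAD; rewrite setD1K // => /le_trans; apply.
rewrite exprS -mulrA ler_wpM2l // (big_setD1 x xA) /= mulrDr addrC lerD //; last exact: IH.
by rewrite ler_peMl ?exprn_ege1 // subr_ge0 sqnorm_E_le.
Qed.

End Poincare.
End SingleSite.

(** * Spectral gap and Poincare inequality *)

Section Gap.
Variables (R : realType) (b : nat) (beta h : R).
Variables (tau : tree b -> bool) (r : tree b) (m : nat).
Local Notation V := (vertex b m).
Local Notation T := (subtree b m).
Local Notation conf := (conf tau r m).
Local Notation E := (condexp beta h).
Local Notation N := (sqnorm beta h T (tau_conf tau r m)).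
Implicit Types (f : conf -> R).

Lemma varTE f : varT beta h f = N f - N (E T f).
Proof. exact: variance_sqnorm. Qed.

Lemma dirichletE f : dirichlet beta h f = \sum_(x in T) (N f - N (E [set x] f)).
Proof. by apply: eq_bigr => x xT; rewrite -E_variance // sub1set. Qed.

Lemma dirichlet_blockE l f :
  dirichlet_block beta h l f = \sum_(x in T) (N f - N (E (block x l) f)).
Proof.
apply: eq_bigr => x xT; rewrite -E_variance //.
exact: subset_trans (block_sub x l) (below_sub x).
Qed.

Lemma dirichlet_ge0 f : 0 <= dirichlet beta h f.
Proof.
rewrite dirichletE; apply: sumr_ge0 => x xT.
by rewrite subr_ge0 sqnorm_E_le // sub1set.
Qed.

Lemma agree_off_subtree (s t : conf) : agree_off T s t.
Proof. by apply/agree_offP => x xT; exact: at_bdry. Qed.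

(** [mu T] charges every configuration, so zero variance would force f to equal its mean
    everywhere. *)
Lemma varT_gt0 f : nonconstant f -> 0 < varT beta h f.
Proof.
case=> s [t st]; rewrite varTE -sqnorm_pyth // lt_neqAle sqnorm_ge0 andbT eq_sym.
apply/negP => /eqP; rewrite /sqnorm /condexp /expect.
move/eqP; rewrite psumr_eq0 => [/allP H|w _]; last by rewrite mulr_ge0 ?mu_ge0 ?sqr_ge0.
have fE w : f w = E T f w.
  have := H w (mem_index_enum _); rewrite implyTb mulf_eq0.
  rewrite gt_eqF ?mu_gt0 ?agree_off_subtree //= sqrf_eq0 subr_eq0.
  by move/eqP.
by apply: st; rewrite fE [RHS]fE; apply: E_indep; exact: agree_off_subtree.
Qed.

Lemma poincare_of_gap (C : R) f : 0 < C -> 1 / C <= cgap beta h tau r m ->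
  varT beta h f <= C * dirichlet beta h f.
Proof.
move=> C0 gap; case: (pselect (nonconstant f)) => [nc|nc]; last first.
  (* Constant functions do not enter the infimum, but their variance is 0. *)
  have fE s : E T f s = f s.
    rewrite (@E_eq _ _ _ _ _ _ _ _ _ (fun=> f s)) ?E_const // => t _.
    by apply: contrapT => st; apply: nc; exists t, s.
  rewrite varTE (_ : E T f = f) ?subrr; last exact: funext.
  by rewrite mulr_ge0 ?dirichlet_ge0 ?ltW.
move: gap; rewrite /cgap; set S := (X in inf X) => gap.
have lb : classical_sets.has_lbound S.
  exists 0 => _ [g gn <-]; rewrite divr_ge0 ?dirichlet_ge0 // ltW //; exact: varT_gt0.
have := le_trans gap (ge_inf lb (ex_intro2 _ _ f nc erefl)).
rewrite ler_pdivlMr ?varT_gt0 // mulrAC mul1r ler_pdivrMr // mulrC.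
by rewrite [X in _ <= X]mulrC.
Qed.

Lemma gap_of_poincare (C : R) : 0 < C ->
  (forall f, varT beta h f <= C * dirichlet beta h f) -> 1 / C <= cgap beta h tau r m.
Proof.
move=> C0 H; apply: lb_le_inf.
  (* The infimum must be over a nonempty set; the spin at the root of T, which is always free,
     supplies a nonconstant function. *)
  pose x0 : V := [bseq].
  have bd (c : bool) : on_bdry tau r [ffun x : V => if x == x0 then c else tau (r ++ x)].
    apply/forallP => x; apply/implyP => xT; rewrite ffunE.
    by case: ifPn => [/eqP x0E|_]; [move: xT; rewrite x0E inE|exact: eqxx].
  pose s (c : bool) : conf := exist (fun u => is_true (on_bdry tau r u)) _ (bd c).
  have sE c : at_ (s c) x0 = c by rewrite /at_ /= ffunE eqxx.
  pose f (t : conf) : R := (at_ t x0)%:R.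
  exists (dirichlet beta h f / varT beta h f), f => //.
  by exists (s true), (s false); rewrite /f !sE; apply/eqP; rewrite oner_eq0.
move=> _ [f fn <-]; rewrite ler_pdivlMr ?varT_gt0 // mulrAC mul1r ler_pdivrMr //.
by rewrite mulrC.
Qed.

End Gap.

(** * From T to its subtrees *)

(** Inside T, only the parent of x is adjacent to T_x from outside. *)
Lemma below_boundary (b m : nat) (x : vertex b m) : exists p, forall y,
  y \in clos (below x) -> y \in subtree b m -> y \notin below x -> y = p.
Proof.
case: (pickP (fun p => child p x)) => [p px|np].
  exists p => y; rewrite in_setU => /orP[-> //|]; rewrite inE.
  case/andP=> _ /existsP[z /andP[zx zy]] yT yx.
  case/orP: zy => [zy|yz].
    by case/negP: yx; exact: child_below zy zx yT.
  case: (parent_below yz zx) => [zE|H]; last by case/negP: yx.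
  by rewrite zE in yz; exact: child_parent_uniq yz px.
(* If x has no parent, the premises on y are contradictory and the witness is arbitrary. *)
exists x => y; rewrite in_setU => /orP[-> //|]; rewrite inE.
case/andP=> _ /existsP[z /andP[zx zy]] yT yx.
case/orP: zy => [zy|yz]; first by rewrite (child_below zy zx) in yx.
case: (parent_below yz zx) => [zE|H]; last by rewrite H in yx.
by rewrite zE np in yz.
Qed.

Section Transfer.
Variables (R : realType) (b : nat) (beta h : R).
Variables (tau : tree b -> bool) (r : tree b) (m : nat).
Local Notation V := (vertex b m).
Local Notation T := (subtree b m).
Local Notation conf := (conf tau r m).
Local Notation E := (condexp beta h).
Local Notation M := (wratio b beta h).
Variables (x : V) (eta : conf).
Local Notation D := (below x).
Implicit Types (A C : {set V}) (y z : V) (s t : conf) (f g u : conf -> R).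

(* Freezing everything off T_x to eta changes the interaction of T_x with its
   outside only through the spin of the parent of x. *)
Lemma E_freeze A u s : A \subset D -> (forall t, 0 <= u t) ->
  E A (fun t => u (patch (~: D) eta t)) s <= M ^+ 2 * E A u (patch (~: D) eta s) /\
  E A u (patch (~: D) eta s) <= M ^+ 2 * E A (fun t => u (patch (~: D) eta t)) s.
Proof.
move=> AD u0; have [p Hp] := below_boundary x.
have H t y : y \in clos D -> y != p -> at_ (patch (~: D) eta t) y = at_ t y.
  move=> yD yp; rewrite at_patch in_setC; case: ifPn => // yxD.
  case: (boolP (y \in T)) => yT; last exact: at_bdry.
  by rewrite (Hp y) ?eqxx in yp.
apply: (E_patch_comp (D := D)) => //.
- by rewrite disjoint_sym disjoints_subset setCK.
- exact/ltW/wratio_gt0.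
- by move=> t _; apply: (@weight_le _ _ _ _ _ _ _ _ p) => y yD yp; rewrite H.
- by move=> t _; apply: (@weight_le _ _ _ _ _ _ _ _ p) => y yD yp; rewrite H.
Qed.

Lemma variance_ge0 A s f : 0 <= variance beta h A s f.
Proof. by rewrite varianceE; apply: E_ge0 => t _; exact: sqr_ge0. Qed.

(** The inequality for T is tested on F, which is f with all spins off T_x frozen to eta. Freezing
    costs [M ^+ 2] three times: in the variance, in the single-site variances, and in averaging the
    latter under eta. Sites outside T_x contribute nothing to the Dirichlet form of F. *)
Lemma poincare_below (C : R) : 0 < C ->
  (forall F : conf -> R, varT beta h F <= C * dirichlet beta h F) ->
  forall f, variance beta h D eta f <=
    M ^+ 6 * C * \sum_(y in D) E D (fun s => variance beta h [set y] s f) eta.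
Proof.
move=> C0 gap f; pose rho := patch (~: D) eta; pose F s := f (rho s).
have M2 : 0 <= M ^+ 2 by exact: sqr_ge0.
have rhoE s : agree_off D eta (rho s).
  by apply/agree_offP => y yD; rewrite at_patch in_setC yD.
have step1 s : variance beta h D eta f <= M ^+ 2 * variance beta h D s F.
  rewrite [in leRHS]varianceE; set c := E D F s.
  have -> : E D (fun t => (F t - E D F t) ^+ 2) s =
      E D (fun t => (fun v => (f v - c) ^+ 2) (rho t)) s.
    by apply: E_eq => t st; rewrite /c (E_indep _ _ _ st).
  have [_] := E_freeze (u := fun v => (f v - c) ^+ 2) s (subxx _) (fun t => sqr_ge0 _).
  apply: le_trans; rewrite -(E_indep _ _ _ (rhoE s)); exact: variance_le_sqdist.
have step2 s y : y \in D ->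
    variance beta h [set y] s F <= M ^+ 2 * variance beta h [set y] (rho s) f.
  move=> yD; have yD1 : [set y] \subset D by rewrite sub1set.
  set c := E [set y] f (rho s).
  apply: le_trans (variance_le_sqdist _ _ _ _ _ c) _.
  have [H _] := E_freeze (u := fun v => (f v - c) ^+ 2) s yD1 (fun t => sqr_ge0 _).
  apply: le_trans H _; rewrite ler_wpM2l // varianceE le_eqVlt; apply/orP; left.
  by apply/eqP/E_eq => t st; rewrite /c (E_indep _ _ _ st).
have var1 : variance beta h D eta f <= M ^+ 2 * varT beta h F.
  apply: (@le_trans _ _ (M ^+ 2 * E T (fun s => variance beta h D s F) (tau_conf tau r m))).
    have -> : M ^+ 2 * E T (fun s => variance beta h D s F) (tau_conf tau r m) =
       E T (fun s => M ^+ 2 * variance beta h D s F) (tau_conf tau r m).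
      by rewrite E_scale.
    rewrite -[leLHS](E_const beta h T _ (tau_conf tau r m)).
    by apply: E_le => s _; exact: step1.
  rewrite ler_wpM2l // E_variance ?below_sub // varTE lerD2l lerN2.
  by apply: sqnorm_mono; rewrite ?below_sub.
have dir : dirichlet beta h F <=
    M ^+ 4 * \sum_(y in D) E D (fun s => variance beta h [set y] s f) eta.
  rewrite dirichletE (bigID [in D]) /= [X in _ + X]big1 ?addr0 => [|y /andP[yT yD]]; last first.
    rewrite E_id ?subrr // => s t st; rewrite /F /rho; congr f.
    apply: conf_ext => z; rewrite !at_patch in_setC; case: ifPn => // /negPn zD.
    by rewrite (agree_offP _ _ _ st) // inE; apply: contraNneq yD => <-.
  rewrite (eq_bigl [in D]); last first.
    by move=> y /=; rewrite andbC; case: (boolP (y \in D)) => // /(subsetP (below_sub x)) ->.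
  rewrite mulr_sumr; apply: ler_sum => y yD.
  have yT : [set y] \subset T by rewrite sub1set (subsetP (below_sub x)).
  rewrite -E_variance //.
  set v := fun s => variance beta h [set y] s f.
  apply: (@le_trans _ _ (E T (fun s => M ^+ 2 * v (rho s)) (tau_conf tau r m))).
    by apply: E_le => s _; exact: step2.
  rewrite E_scale -(E_tower _ _ _ (below_sub x)).
  rewrite (_ : M ^+ 4 = M ^+ 2 * M ^+ 2); last by ring.
  rewrite -mulrA ler_wpM2l //.
  rewrite -[leRHS](E_const beta h T _ (tau_conf tau r m)).
  apply: E_le => s _; have [H _] := E_freeze (u := v) s (subxx _) (variance_ge0 _ ^~ f).
  by apply: le_trans H _; rewrite -(E_indep _ _ _ (rhoE s)).
apply: le_trans var1 _.
have -> : M ^+ 6 * C * \sum_(y in D) E D (fun s => variance beta h [set y] s f) eta =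
  M ^+ 2 * (C * (M ^+ 4 * \sum_(y in D) E D (fun s => variance beta h [set y] s f) eta)) by ring.
rewrite ler_wpM2l //; apply: le_trans (gap F) _.
by rewrite ler_wpM2l // ltW.
Qed.

End Transfer.

(** * Finite speed of propagation *)

Lemma sqr_sum_le (R : realType) (I : finType) (A : {set I}) (a : I -> R) :
  (\sum_(i in A) a i) ^+ 2 <= #|A|%:R * \sum_(i in A) a i ^+ 2.
Proof.
set n := #|A|%:R; set s := \sum_(i in A) a i.
case: (posnP #|A|) => [/eqP|A0].
  by rewrite cards_eq0 /n /s => /eqP ->; rewrite !big_set0 expr0n /= mulr0.
have n0 : 0 < n by rewrite ltr0n.
have : 0 <= \sum_(i in A) (n * a i - s) ^+ 2 by apply: sumr_ge0 => i _; exact: sqr_ge0.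
have -> : \sum_(i in A) (n * a i - s) ^+ 2 =
   \sum_(i in A) (n ^+ 2 * a i ^+ 2 + ((- 2 * n * s) * a i + s ^+ 2)).
  by apply: eq_bigr => i _; ring.
rewrite !big_split /= sumr_const -[s ^+ 2 *+ _]mulr_natr -/n -!mulr_sumr -/s.
set q := \sum_(i in A) _ => H.
rewrite -subr_ge0 -(pmulr_rge0 _ n0).
by have -> : n * (n * q - s ^+ 2) = n ^+ 2 * q + (- 2 * n * s * s + s ^+ 2 * n) by ring.
Qed.

(** * The L2 norm *)

Section L2Norm.
Variables (R : realType) (b : nat) (beta h : R).
Variables (tau : tree b -> bool) (r : tree b) (m : nat).
Local Notation V := (vertex b m).
Local Notation conf := (conf tau r m).
Local Notation E := (condexp beta h).
Variables (D : {set V}) (eta : conf).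
Local Notation N := (sqnorm beta h D eta).
Implicit Types (f g : conf -> R) (s t : conf).

Definition l2norm f : R := Num.sqrt (N f).

Lemma l2norm_ge0 f : 0 <= l2norm f.
Proof. exact: sqrtr_ge0. Qed.

Lemma l2norm_sqr f : l2norm f ^+ 2 = N f.
Proof. by rewrite sqr_sqrtr ?sqnorm_ge0. Qed.

Lemma sqnorm_lin f g (a c : R) : N (fun s => a * f s + c * g s) =
  a ^+ 2 * N f + 2 * a * c * E D (fun s => f s * g s) eta + c ^+ 2 * N g.
Proof.
rewrite /sqnorm.
have -> : (fun s => (a * f s + c * g s) ^+ 2) =
    (fun s => (a ^+ 2 * f s ^+ 2 + (2 * a * c) * (f s * g s)) + c ^+ 2 * g s ^+ 2).
  by apply: funext => s; ring.
by rewrite !E_add !E_scale.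
Qed.

Lemma cauchy_schwarz f g : E D (fun s => f s * g s) eta <= l2norm f * l2norm g.
Proof.
set p := E D _ eta; apply: le_trans (ler_norm _) _.
rewrite -(@ler_pXn2r _ 2) ?nnegrE ?normr_ge0 ?mulr_ge0 ?l2norm_ge0 //.
rewrite exprMn !l2norm_sqr real_normK ?num_real //.
have Nf := sqnorm_ge0 beta h D eta f; have Ng := sqnorm_ge0 beta h D eta g.
have H a c : 0 <= a ^+ 2 * N f + 2 * a * c * p + c ^+ 2 * N g.
  by rewrite -sqnorm_lin sqnorm_ge0.
(* The quadratic form is evaluated at (N g, - p); when N g = 0 that is uninformative, and (p, - (N f
   + 1)) forces p = 0 instead. *)
case: (eqVneq (N g) 0) => g0.
  have := H p (- (N f + 1)); rewrite g0 !mulr0 addr0.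
  have -> : p ^+ 2 * N f + 2 * p * - (N f + 1) * p = - (p ^+ 2 * (N f + 2)) by ring.
  rewrite oppr_ge0 pmulr_lle0 //; lra.
have gpos : 0 < N g by rewrite lt_def g0.
have := H (N g) (- p).
have -> : N g ^+ 2 * N f + 2 * N g * - p * p + (- p) ^+ 2 * N g =
   N g * (N f * N g - p ^+ 2) by ring.
by rewrite pmulr_rge0 // subr_ge0.
Qed.

Lemma l2normD f g : l2norm (fun s => f s + g s) <= l2norm f + l2norm g.
Proof.
rewrite -(@ler_pXn2r _ 2) ?nnegrE ?addr_ge0 ?l2norm_ge0 // l2norm_sqr.
have := sqnorm_lin f g 1 1.
have -> : (fun s => 1 * f s + 1 * g s) = (fun s => f s + g s).
  by apply: funext => s; rewrite !mul1r.
move=> ->; have := cauchy_schwarz f g.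
rewrite sqrrD !l2norm_sqr !expr1n; lra.
Qed.

Lemma l2norm_le_sup f e : 0 <= e -> (forall s, `|f s| <= e) -> l2norm f <= e.
Proof.
move=> e0 H; rewrite -(@ler_pXn2r _ 2) ?nnegrE ?l2norm_ge0 // l2norm_sqr.
rewrite -[leRHS](E_const beta h D _ eta); apply: E_le => s _.
by rewrite -[f s ^+ 2]real_normK ?num_real // ler_pXn2r ?nnegrE.
Qed.

End L2Norm.

Section Dynamics.
Variables (R : realType) (b : nat) (beta h : R).
Variables (tau : tree b -> bool) (r : tree b) (m : nat).
Local Notation V := (vertex b m).
Local Notation T := (subtree b m).
Local Notation conf := (conf tau r m).
Local Notation E := (condexp beta h).
Implicit Types (x y z : V) (f g : conf -> R) (s t : conf).

Definition osc_bound g (O : V -> R) := forall y s s',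
  agree_off [set y] s s' -> `|g s - g s'| <= O y.

Lemma osc_bound_ge0 g O y : osc_bound g O -> 0 <= O y.
Proof.
move=> H; have s := tau_conf tau r m.
by apply: le_trans (H y s s (agree_refl _ _)); exact: normr_ge0.
Qed.

Lemma E_norm_le A f s e : (forall t, agree_off A s t -> `|f t| <= e) -> `|E A f s| <= e.
Proof.
move=> H; rewrite ler_norml -{1}(E_const beta h A (- e) s) -{2}(E_const beta h A e s).
by apply/andP; split; apply: E_le => t /H; rewrite ler_norml => /andP[].
Qed.

Lemma osc_site g O y s : osc_bound g O -> `|E [set y] g s - g s| <= O y.
Proof.
move=> H; have -> : E [set y] g s - g s = E [set y] (fun t => g t - g s) s.
  by rewrite E_sub E_const.
by apply: E_norm_le => t st; rewrite distrC; exact: H.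
Qed.

(** Resampling z = y erases the dependence on y. If z is not adjacent to y, its conditional law is
    the same for s and s'. If it is adjacent, undoing the resampling on each side costs at most
    [O z]. *)
Lemma osc_E g O z y s s' : osc_bound g O -> agree_off [set y] s s' ->
  `|E [set z] g s - E [set z] g s'| <= O y + 2 * (if adj z y then O z else 0).
Proof.
move=> H ss'; have O0 v : 0 <= O v by exact: osc_bound_ge0 H.
case: (eqVneq y z) => [yz|yz].
  subst z; rewrite (E_indep _ _ _ ss') subrr normr0 addr_ge0 // mulr_ge0 //.
  by case: ifP.
case: ifPn => zy.
  have -> : E [set z] g s - E [set z] g s' =
     (E [set z] g s - g s) + (g s - g s') + (g s' - E [set z] g s') by ring.
  apply: le_trans (ler_normD _ _) _.
  have H1 := osc_site z s H; have H2 := osc_site z s' H; have H3 := H _ _ _ ss'.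
  have H4 := ler_normD (E [set z] g s - g s) (g s - g s').
  rewrite [X in _ + X <= _]distrC; lra.
rewrite mulr0 addr0.
have sep : separated [set y] [set z].
  by apply: separatedI => v w; rewrite !inE => /eqP -> /eqP ->; rewrite yz /adj orbC.
have -> : E [set z] g s' = E [set z] (fun t => g (patch [set y] s' t)) s.
  by rewrite E_patch_eq // patchK.
have -> : E [set z] g s - E [set z] (fun t => g (patch [set y] s' t)) s =
   E [set z] (fun t => g t - g (patch [set y] s' t)) s by rewrite E_sub.
by apply: E_norm_le => t _; apply: H; exact: patch_agree.
Qed.

(** The weight doubles with depth, so a bound on the mass bounds oscillations at depth d by [2 ^- d]
    times that mass. *)
Definition osc_mass (O : V -> R) : R := \sum_(y : V) 2 ^+ size y * O y.

(** At most b children of doubled weight, and at most one parent. *)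
Lemma adj_weight z :
  \sum_(y : V | adj z y) 2 ^+ size y <= (2 * b + 1)%:R * 2 ^+ size z :> R.
Proof.
have H : \sum_(y : V | adj z y) 2 ^+ size y <=
   \sum_(y : V | child z y) 2 ^+ size y + \sum_(y : V | child y z) 2 ^+ size y :> R.
  rewrite (bigID (fun y => child z y)) /= ; apply: lerD.
    rewrite le_eqVlt; apply/orP; left; apply/eqP/eq_bigl => y.
    by rewrite /adj; case: (child z y); rewrite ?andbF.
  rewrite [leLHS]big_mkcond [leRHS]big_mkcond; apply: ler_sum => y _.
  rewrite /adj; case: (child z y) => /=; case: (child y z) => //=; exact: exprn_ge0.
apply: le_trans H _; rewrite natrD mulrDl mul1r; apply: lerD.
  rewrite (eq_bigr (fun=> 2 ^+ (size z).+1)) => [|y zy]; last by rewrite (size_child zy).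
  rewrite sumr_const -[leLHS]mulr_natr exprS natrM mulrAC ler_wpM2r ?exprn_ge0 //.
  rewrite ler_wpM2l // ler_nat; apply: leq_trans (card_children z).
  by apply/eq_leq/eq_card => y; rewrite inE.
apply: (@le_trans _ _ (\sum_(y : V | child y z) 2 ^+ size z)).
  by apply: ler_sum => y yz; rewrite (size_child yz) ler_eXn2l ?ltr1n.
rewrite sumr_const -[leLHS]mulr_natr -[leRHS]mulr1 ler_wpM2l ?exprn_ge0 // (ler_nat _ _ 1).
apply: leq_trans (card_parents z).
by apply/eq_leq/eq_card => y; rewrite inE.
Qed.

Definition osc_next (c : R) (O : V -> R) y : R := O y + c * \sum_(z | adj z y) O z.

Lemma osc_mass_next c O : 0 <= c -> (forall y, 0 <= O y) ->
  osc_mass (osc_next c O) <= (1 + c * (2 * b + 1)%:R) * osc_mass O.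
Proof.
move=> c0 O0; rewrite /osc_mass /osc_next.
under eq_bigr do rewrite mulrDr mulrCA mulr_sumr.
rewrite big_split /= mulrDl mul1r lerD2l -mulr_sumr -mulrA ler_wpM2l //.
rewrite (exchange_big_dep predT) //= mulr_sumr; apply: ler_sum => z _.
rewrite -mulr_suml mulrA ler_wpM2r //; exact: adj_weight.
Qed.

End Dynamics.

(** * Heat-bath dynamics restricted to a block *)

Section BlockDynamics.
Variables (R : realType) (b : nat) (beta h : R).
Variables (tau : tree b -> bool) (r : tree b) (m : nat).
Local Notation V := (vertex b m).
Local Notation T := (subtree b m).
Local Notation conf := (conf tau r m).
Local Notation E := (condexp beta h).
Variables (x : V) (l : nat) (eta : conf) (K : R).
Hypothesis xT : x \in T.
Local Notation D := (below x).
Local Notation B := (block x l).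
Local Notation N := (sqnorm beta h D eta).
Local Notation n := (#|D|%:R : R).
Hypothesis K1 : 1 <= K.
Hypothesis poincare : forall f : conf -> R,
  N f - N (E D f) <= K * \sum_(y in D) (N f - N (E [set y] f)).
Implicit Types (y z : V) (f g : conf -> R) (s t : conf).

Definition scan g : conf -> R := fun s => n^-1 * \sum_(y in D) E [set y] g s.

(* As an operator it is self-adjoint for mu_{T_x}^eta and fixes every function
   that does not depend on the block. *)
Definition block_scan g : conf -> R := fun s =>
  n^-1 * \sum_(y in D) (if y \in B then E [set y] g s else g s).

Lemma card_below_gt0 : (0 < #|D|)%N.
Proof. by apply/card_gt0P; exists x; exact: below_refl. Qed.

Lemma nbelow_gt0 : 0 < n.
Proof. by rewrite ltr0n card_below_gt0. Qed.

Lemma site_sub y : y \in D -> [set y] \subset D.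
Proof. by rewrite sub1set. Qed.

Lemma block_scan_dual g f : indep_of B f ->
  E D (fun s => block_scan g s * f s) eta = E D (fun s => g s * f s) eta.
Proof.
move=> fB; rewrite /block_scan.
have -> : (fun s => n^-1 * (\sum_(y in D) (if y \in B then E [set y] g s else g s)) * f s) =
  (fun s => n^-1 * \sum_(y in D) ((if y \in B then E [set y] g s else g s) * f s)).
  by apply: funext => s; rewrite -mulrA mulr_suml.
rewrite E_scale E_sum (eq_bigr (fun=> E D (fun s => g s * f s) eta)).
  by rewrite sumr_const -[X in _ * X]mulr_natl mulKf // lt0r_neq0 ?nbelow_gt0.
move=> y yD; case: (boolP (y \in B)) => // yB; rewrite E_selfadj ?site_sub //.
have yf : indep_of [set y] f by apply: indepW fB; rewrite sub1set.
by rewrite (E_id _ _ yf).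
Qed.

Lemma scan_sub_const g c : scan (fun s => g s - c) = fun s => scan g s - c.
Proof.
apply: funext => s; rewrite /scan.
rewrite (eq_bigr (fun y => E [set y] g s - c)) => [|y _]; last by rewrite E_sub E_const.
rewrite sumrB sumr_const -[c *+ _]mulr_natl mulrBr mulKf //.
by rewrite lt0r_neq0 ?nbelow_gt0.
Qed.

(** With a = 1 / (K n), squared norms of centred functions contract by 1 - a, which is at most (1 -
    a / 2) ^ 2; [rate] is 1 - a / 2. *)
Definition rate : R := 1 - (2 * K * n)^-1.

Lemma rate_ge0 : 0 <= rate.
Proof.
have n1 : 1 <= n by rewrite (ler_nat _ 1) card_below_gt0.
rewrite /rate subr_ge0 invf_le1; first by rewrite -[1]mulr1 ler_pM //; have := K1; lra.
rewrite mulr_gt0 ?nbelow_gt0 //; have := K1; lra.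
Qed.

Lemma rate_le1 : rate <= 1.
Proof.
rewrite /rate gerBl invr_ge0 mulr_ge0 //; have := K1; lra.
Qed.

(** Convexity of the square bounds the norm of the average over sites by the average of norms, to
    which the Poincare inequality applies. *)
Lemma scan_contract g : E D g eta = 0 ->
  l2norm beta h D eta (scan g) <= rate * l2norm beta h D eta g.
Proof.
move=> g0.
have Ng := sqnorm_ge0 beta h D eta g.
have n0 := nbelow_gt0; have K0 : 0 < K by apply: lt_le_trans K1.
have N0 : N (E D g) = 0.
  rewrite /sqnorm (@E_eq _ _ _ _ _ _ _ _ _ (fun=> 0)) ?E_const // => s es.
  by rewrite -(E_indep _ _ _ es) g0 expr0n.
have H1 : N (scan g) <= n^-1 * \sum_(y in D) N (E [set y] g).
  have -> : n^-1 * \sum_(y in D) N (E [set y] g) =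
    E D (fun s => n^-1 * \sum_(y in D) E [set y] g s ^+ 2) eta.
    by rewrite E_scale E_sum.
  apply: E_le => s _; rewrite /scan exprMn [_^-1 ^+ 2]expr2 -mulrA ler_wpM2l ?invr_ge0 ?(ltW n0) //.
  by rewrite ler_pdivrMl // sqr_sum_le.
have H2 : \sum_(y in D) N (E [set y] g) = n * N g - \sum_(y in D) (N g - N (E [set y] g)).
  by rewrite sumrB sumr_const -[N g *+ _]mulr_natl opprB addrC subrK.
have H3 : N (scan g) <= rate ^+ 2 * N g.
  apply: le_trans H1 _; rewrite H2 mulrBr mulKf ?lt0r_neq0 //.
  have := poincare g; rewrite N0 subr0 -ler_pdivrMl // => H.
  have H4 : n^-1 * (K^-1 * N g) <= n^-1 * \sum_(y in D) (N g - N (E [set y] g)).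
    by rewrite ler_wpM2l // invr_ge0 ltW.
  have H5 : (2 * K * n)^-1 = 2^-1 * (n^-1 * K^-1) by rewrite -!invfM; congr (_^-1); ring.
  rewrite /rate H5; set a := n^-1 * K^-1 in H5 *.
  have H6 : 0 <= (2^-1 * a) ^+ 2 * N g by rewrite mulr_ge0 ?sqr_ge0.
  have -> : (1 - 2^-1 * a) ^+ 2 * N g = N g - a * N g + (2^-1 * a) ^+ 2 * N g by field.
  move: H4; rewrite mulrA -/a; lra.
rewrite /l2norm -[X in _ <= X * _](ger0_norm rate_ge0) -sqrtr_sqr -sqrtrM ?sqr_ge0 //.
exact: ler_wsqrtr.
Qed.

Lemma osc_block_scan g O : osc_bound g O -> osc_bound (block_scan g) (osc_next (2 / n) O).
Proof.
move=> H y s s' ss'; have O0 v : 0 <= O v by exact: osc_bound_ge0 H.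
have n0 := nbelow_gt0.
rewrite /block_scan -mulrBr -sumrB normrM ger0_norm ?invr_ge0 ?(ltW n0) //.
rewrite ler_pdivrMl //; apply: le_trans (ler_norm_sum _ _ _) _.
apply: (@le_trans _ _ (\sum_(z in D) (O y + 2 * (if adj z y then O z else 0)))).
  apply: ler_sum => z _; case: ifP => _; first exact: osc_E.
  apply: le_trans (H _ _ _ ss') _; rewrite lerDl mulr_ge0 //; by case: ifP.
rewrite big_split /= sumr_const -[O y *+ _]mulr_natl /osc_next mulrDr lerD2l.
rewrite -mulr_sumr mulrA mulrCA divff ?lt0r_neq0 // mulr1 ler_wpM2l //.
rewrite [leLHS]big_mkcond [leRHS]big_mkcond; apply: ler_sum => z _ /=.
by case: (z \in D) => //; case: ifP.
Qed.

(** The two differ only at sites of T_x outside the block, whose depth is at least [size x + l] and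
    whose weight in [osc_mass] is therefore at least [2 ^+ (size x + l)]. *)
Lemma block_scan_near g O s : osc_bound g O ->
  `|block_scan g s - scan g s| <= n^-1 * (2 ^- (size x + l) * osc_mass O).
Proof.
move=> H; have O0 v : 0 <= O v by exact: osc_bound_ge0 H.
have n0 := nbelow_gt0.
rewrite /block_scan /scan -mulrBr -sumrB normrM ger0_norm ?invr_ge0 ?(ltW n0) //.
rewrite ler_wpM2l ?invr_ge0 ?(ltW n0) //.
apply: le_trans (ler_norm_sum _ _ _) _.
rewrite /osc_mass mulr_sumr [leLHS]big_mkcond; apply: ler_sum => y _ /=.
have P0 : 0 <= 2 ^- (size x + l) * (2 ^+ size y * O y).
  by rewrite !mulr_ge0 ?invr_ge0 ?exprn_ge0.
case: ifPn => // yD; case: ifPn => yB; first by rewrite subrr normr0.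
rewrite distrC; apply: le_trans (osc_site beta h y s H) _.
rewrite mulrA ler_peMl // ler_pdivlMl ?exprn_gt0 // mulr1 ler_eXn2l ?ltr1n //.
by move: yB; rewrite inE yD /= -leqNgt.
Qed.

Definition growth : R := 1 + 2 / n * (2 * b + 1)%:R.

Lemma growth_ge1 : 1 <= growth.
Proof. by rewrite /growth lerDl !mulr_ge0 ?invr_ge0. Qed.

Variables (k : conf -> R) (w : R).
Hypothesis w0 : 0 <= w.
Hypothesis osck : osc_bound k (fun y => if y == x then w else 0).

Let g j := iter j block_scan k.
Let c := E D k eta.

Lemma osc_iter j : exists O, osc_bound (g j) O /\
  osc_mass O <= growth ^+ j * (2 ^+ size x * w).
Proof.
elim: j => [|j [O [HO mO]]].
  exists (fun y => if y == x then w else 0); split; first exact: osck.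
  rewrite /osc_mass (bigD1 x) //= eqxx big1 ?addr0 ?mul1r // => y /negbTE ->.
  by rewrite mulr0.
exists (osc_next (2 / n) O); split; first exact: osc_block_scan.
apply: le_trans (osc_mass_next _ _) _.
- by rewrite mulr_ge0 ?invr_ge0.
- by move=> y; exact: osc_bound_ge0 HO.
by rewrite exprS -mulrA ler_wpM2l // (le_trans ler01) ?growth_ge1.
Qed.

Lemma iter_dual j f : indep_of B f ->
  E D (fun s => g j s * f s) eta = E D (fun s => k s * f s) eta.
Proof. by move=> fB; elim: j => //= j IH; rewrite block_scan_dual. Qed.

Lemma iter_mean j : E D (g j) eta = c.
Proof.
have := @iter_dual j (fun=> 1) (fun _ _ _ => erefl).
by under E_eq do rewrite mulr1; move=> ->; apply: E_eq => s _; rewrite mulr1.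
Qed.

(** Each step is a full scan, contracting by [rate], plus the error of [block_scan_near]. The j
    errors are all bounded by the largest power of [growth], and the factor [2 ^+ size x] of the
    initial mass cancels. *)
Lemma iter_contract j : l2norm beta h D eta (fun s => g j s - c) <=
  rate ^+ j * l2norm beta h D eta (fun s => k s - c)
  + j%:R * (n^-1 * (2 ^- l * (growth ^+ j * w))).
Proof.
have n0 := nbelow_gt0.
elim: j => [|j IH]; first by rewrite mul1r mul0r addr0.
have -> : (fun s => g j.+1 s - c) = (fun s => scan (fun t => g j t - c) s +
    (block_scan (g j) s - scan (g j) s)).
  by apply: funext => s; rewrite scan_sub_const /g /=; ring.
apply: le_trans (l2normD _ _ _ _ _ _) _.
have e0 i : 0 <= n^-1 * (2 ^- l * (growth ^+ i * w)).
  by rewrite !mulr_ge0 ?invr_ge0 ?exprn_ge0 ?(le_trans ler01 growth_ge1) ?(ltW n0).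
have H1 : l2norm beta h D eta (scan (fun t => g j t - c)) <=
    rate * l2norm beta h D eta (fun t => g j t - c).
  by apply: scan_contract; rewrite E_sub E_const iter_mean subrr.
have H2 : l2norm beta h D eta (fun s => block_scan (g j) s - scan (g j) s) <=
    n^-1 * (2 ^- l * (growth ^+ j * w)).
  apply: l2norm_le_sup => // s; have [O [HO mO]] := osc_iter j.
  apply: le_trans (block_scan_near s HO) _.
  rewrite ler_wpM2l ?invr_ge0 ?(ltW n0) // exprD invfM -mulrA.
  rewrite ler_pdivrMl ?exprn_gt0 // mulrCA ler_wpM2l ?invr_ge0 ?exprn_ge0 //.
  by apply: le_trans mO _; rewrite mulrCA.
have H3 : n^-1 * (2 ^- l * (growth ^+ j * w)) <= n^-1 * (2 ^- l * (growth ^+ j.+1 * w)).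
  rewrite !ler_wpM2l ?invr_ge0 ?exprn_ge0 ?(ltW n0) // ler_wpM2r // exprS ler_peMl //.
    by rewrite exprn_ge0 // (le_trans ler01 growth_ge1).
  exact: growth_ge1.
have H4 : rate * l2norm beta h D eta (fun t => g j t - c) <=
  rate * (rate ^+ j * l2norm beta h D eta (fun s => k s - c)
  + j%:R * (n^-1 * (2 ^- l * (growth ^+ j * w)))) by rewrite ler_wpM2l ?rate_ge0.
have H5 : rate * (j%:R * (n^-1 * (2 ^- l * (growth ^+ j * w)))) <=
   j%:R * (n^-1 * (2 ^- l * (growth ^+ j.+1 * w))).
  apply: (@le_trans _ _ (j%:R * (n^-1 * (2 ^- l * (growth ^+ j * w))))).
    by rewrite ler_piMl ?rate_le1 // mulr_ge0.
  by rewrite ler_wpM2l.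
have e1 u : rate ^+ j.+1 * u = rate * (rate ^+ j * u) by rewrite exprS mulrA.
have e2 u : j.+1%:R * u = j%:R * u + u :> R by rewrite -natr1 mulrDl mul1r.
rewrite e1 e2; move: H4; rewrite [leRHS]mulrDr; lra.
Qed.

End BlockDynamics.

(** * Decay of the variance of the projected function *)

Section Mixing.
Variables (R : realType) (b : nat) (beta h : R).
Variables (tau : tree b -> bool) (r : tree b) (m : nat).
Local Notation V := (vertex b m).
Local Notation T := (subtree b m).
Local Notation conf := (conf tau r m).
Local Notation E := (condexp beta h).
Variables (x : V) (l : nat) (eta : conf) (K : R).
Hypothesis xT : x \in T.
Local Notation D := (below x).
Local Notation B := (block x l).
Local Notation N := (sqnorm beta h D eta).
Local Notation norm := (l2norm beta h D eta).
Local Notation n := (#|D|%:R : R).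
Local Notation pmin := (pmin b beta h).
Hypothesis K1 : 1 <= K.
Hypothesis poincare : forall f : conf -> R,
  N f - N (E D f) <= K * \sum_(y in D) (N f - N (E [set y] f)).
Implicit Types (y z : V) (f g : conf -> R) (s t : conf).

(** Exponential rates when [#|D|] updates count as one unit of time: [gamma] for the contraction,
    [kappa] for the growth of the oscillation mass. *)
Definition gamma : R := (2 * K)^-1.
Definition kappa : R := 2 * (2 * b + 1)%:R.

Lemma rate_exp q : rate x K ^+ (q * #|D|) <= expR (- (gamma * q%:R)).
Proof.
have n0 : 0 < n by exact: nbelow_gt0.
have -> : - (gamma * q%:R) = (q * #|D|)%:R * (- (2 * K * n)^-1).
  by rewrite natrM /gamma; field; rewrite lt0r_neq0 //= lt0r_neq0 //; have := K1; lra.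
rewrite expRM_natl; apply: lerXn2r; rewrite ?nnegrE ?rate_ge0 ?expR_ge0 //.
exact: expR_ge1Dx.
Qed.

Lemma growth_exp q : growth R x ^+ (q * #|D|) <= expR (kappa * q%:R).
Proof.
have n0 : 0 < n by exact: nbelow_gt0.
have -> : kappa * q%:R = (q * #|D|)%:R * (2 / n * (2 * b + 1)%:R).
  by rewrite natrM /kappa; field; rewrite lt0r_neq0.
rewrite expRM_natl; apply: lerXn2r; rewrite ?nnegrE ?expR_ge0 //.
  by rewrite (le_trans ler01) ?growth_ge1.
exact: expR_ge1Dx.
Qed.

(** Either spin value at x has conditional probability at least [pmin], so for a function of that
    spin the L2 norm controls the supremum. *)
Lemma sup_root_fun k c s : (forall s s', at_ s x = at_ s' x -> k s = k s') ->
  Num.sqrt pmin * `|k s - c| <= norm (fun t => k t - c).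
Proof.
move=> kx; have p0 := pmin_gt0 b beta h.
rewrite -(@ler_pXn2r _ 2) ?nnegrE ?l2norm_ge0 ?mulr_ge0 ?sqrtr_ge0 //.
rewrite exprMn sqr_sqrtr ?(ltW p0) // real_normK ?num_real // l2norm_sqr /sqnorm.
have xD : [set x] \subset D by rewrite sub1set below_refl.
rewrite -(E_tower _ _ _ xD) -[leLHS](E_const beta h D _ eta).
apply: E_le => t _.
have -> : k s = k (patch [set x] s t) by apply: kx; rewrite at_patch inE eqxx.
apply: (@E_site_ge _ _ _ _ _ _ _ x (fun v => (k v - c) ^+ 2)); last exact: patch_agree.
by move=> v; exact: sqr_ge0.
Qed.

Definition mix_rate q : R := expR (- (gamma * q%:R)) +
  q%:R * (2 ^- l * (expR (kappa * q%:R) * (2 / Num.sqrt pmin))).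

(** The variance of the projection equals its covariance with f. Running the block dynamics on the
    projection keeps this covariance but shrinks its norm by [mix_rate q]; Cauchy-Schwarz
    concludes. *)
Lemma variance_mixing f q : indep_of B f ->
  variance beta h D eta (E (sbelow x) f) <= mix_rate q ^+ 2 * variance beta h D eta f.
Proof.
(* Patching makes k a function of the spin at x on all configurations, while kb is one only on the
   class of eta. *)
move=> fB; pose kb := E (sbelow x) f; pose k s := kb (patch D s eta).
pose c := E D k eta; have n0 : 0 < n by exact: nbelow_gt0.
have kkb s : agree_off D eta s -> k s = kb s by move=> es; rewrite /k patchK.
have kx s s' : at_ s x = at_ s' x -> k s = k s'.
  move=> ss; apply: E_indep; apply/agree_offP => y; rewrite in_setD1 !at_patch.
  by rewrite negb_and negbK => /orP[/eqP ->|/negbTE ->] //; rewrite below_refl.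
have ckb : c = E D kb eta by exact: E_eq.
have cf : c = E D f eta by rewrite ckb E_tower ?sbelow_sub.
pose a := norm (fun s => k s - c); have a0 : 0 <= a by exact: l2norm_ge0.
have vk : variance beta h D eta kb = a ^+ 2.
  rewrite l2norm_sqr varianceE; apply: E_eq => s es.
  by rewrite kkb // ckb (E_indep _ _ _ es).
have vf : variance beta h D eta f = norm (fun s => f s - c) ^+ 2.
  by rewrite l2norm_sqr varianceE; apply: E_eq => s es; rewrite cf (E_indep _ _ _ es).
pose sp := Num.sqrt pmin; have sp0 : 0 < sp by rewrite sqrtr_gt0 pmin_gt0.
pose w := 2 / sp * a; have w0 : 0 <= w by rewrite !mulr_ge0 ?invr_ge0 ?(ltW sp0).
have osck : osc_bound k (fun y => if y == x then w else 0).
  move=> y s s' /agree_offP ss; case: ifPn => [_|yx]; last first.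
    by rewrite (kx s s') ?subrr ?normr0 // ss // inE eq_sym.
  have -> : k s - k s' = (k s - c) - (k s' - c) by ring.
  apply: le_trans (ler_normB _ _) _; rewrite /w mulrAC ler_pdivlMr //.
  have := sup_root_fun c s kx; have := sup_root_fun c s' kx; rewrite -/sp -/a; lra.
pose j := (q * #|D|)%N; pose g := iter j (block_scan beta h x l) k.
have H1 : norm (fun s => g s - c) <= mix_rate q * a.
  apply: le_trans (iter_contract l xT K1 poincare w0 osck j) _.
  rewrite /mix_rate mulrDl; apply: lerD.
    by rewrite ler_wpM2r // rate_exp.
  rewrite -/a natrM; set e := expR _.
  have -> : q%:R * (2 ^- l * (e * (2 / Num.sqrt pmin))) * a = q%:R * (2 ^- l * (e * w)).
    by rewrite /w /sp -!(mulrA q%:R) -!(mulrA (2 ^- l)) -(mulrA e).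
  rewrite -(mulrA q%:R) mulVKf ?lt0r_neq0 // ler_wpM2l // ler_wpM2l ?invr_ge0 ?exprn_ge0 //.
  by rewrite ler_wpM2r // growth_exp.
(* [iter_dual] replaces g by k in the covariance, and self-adjointness of [E (sbelow x)] identifies
   the result with the variance of kb. *)
have H2 : variance beta h D eta kb <= norm (fun s => g s - c) * norm (fun s => f s - c).
  apply: le_trans (cauchy_schwarz _ _ _ _ _ _).
  have -> : E D (fun s => (g s - c) * (f s - c)) eta =
            E D (fun s => g s * (f s - c) - c * (f s - c)) eta.
    by congr (E D _ eta); apply: funext => s; ring.
  rewrite E_sub E_scale E_sub E_const -cf subrr mulr0 subr0.
  rewrite iter_dual //; last by move=> s s' /fB ->.
  rewrite (@E_eq _ _ _ _ _ _ _ _ _ (fun s => kb s * f s - c * kb s)); last first.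
    by move=> s /kkb ->; ring.
  rewrite E_sub E_scale -ckb E_selfadj ?sbelow_sub // varianceE.
  rewrite (@E_eq _ _ _ _ _ _ _ _ _ (fun s => (kb s * kb s - 2 * c * kb s) + c ^+ 2)); last first.
    by move=> s es; rewrite -(E_indep _ _ _ es) -ckb; ring.
  rewrite E_add E_sub E_scale E_const -ckb.
  have -> : E D (fun s => kb s * kb s) eta = E D (fun s => f s * kb s) eta.
    by rewrite E_selfadj ?sbelow_sub // (E_id _ _ (E_indep _ _ _)).
  lra.
set F := norm _ in vf H2.
have F0 : 0 <= F by exact: l2norm_ge0.
have d0 : 0 <= mix_rate q.
  by rewrite addr_ge0 ?expR_ge0 // !mulr_ge0 ?invr_ge0 ?exprn_ge0 ?expR_ge0 ?sqrtr_ge0.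
rewrite -/kb vk vf -exprMn ler_pXn2r ?nnegrE ?mulr_ge0 //.
case: (eqVneq a 0) => [->|an0]; first by rewrite mulr_ge0.
have ap : 0 < a by rewrite lt_def an0.
rewrite -(ler_pM2l ap) -expr2 -vk; apply: le_trans H2 _.
by rewrite mulrCA mulrA ler_wpM2r // mulrC.
Qed.

End Mixing.

(** * The theorem *)

(** The number q of time units is taken proportional to l, slow enough that [2 ^- l] beats the
    growth of influence. *)
Lemma mix_rate_exp (R : realType) (b : nat) (beta h K : R) : 1 <= K ->
  exists c theta : R, [/\ 0 < c, 0 < theta &
    forall l : nat, exists q : nat,
      mix_rate b beta h l K q ^+ 2 <= c * expR (- (theta * l%:R))].
Proof.
(* Every k0 levels of the block must absorb a factor [expR (kappa R b + 2)]. *)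
move=> K1; pose k0 := (Num.bound (expR (kappa R b + 2))).+1.
have k0_gt0 : (0 < k0)%N by [].
have k0R : 0 < k0%:R :> R by rewrite ltr0n.
have Hk0 : expR (kappa R b + 2) <= 2 ^+ k0.
  apply: le_trans (ltW (archi_boundP (expR_ge0 _))) _.
  by rewrite -natrX ler_nat ltnW // (leq_trans (ltnSn _)) // ltnW // ltn_expl.
have g0 : 0 < gamma K by rewrite invr_gt0 mulr_gt0 //; lra.
have g1 : gamma K <= 1.
  rewrite invf_le1 ?mulr_gt0 //; lra.
pose sp := Num.sqrt (pmin b beta h); have sp0 : 0 < sp by rewrite sqrtr_gt0 pmin_gt0.
pose c1 := 1 + 2 / sp.
have c10 : 0 < c1 by rewrite ltr_wpDr // divr_ge0 // ltW.
(* The factor [expR (2 * gamma K)] pays for rounding l / k0 down to q. *)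
exists (c1 ^+ 2 * expR (2 * gamma K)), (2 * gamma K / k0%:R); split.
- by rewrite mulr_gt0 ?exprn_gt0 ?expR_gt0.
- by rewrite divr_gt0 ?mulr_gt0.
move=> l; pose q := (l %/ k0)%N; exists q.
(* Once [2 ^- l] has absorbed the growth, exp(- 2 q) remains; with q <= exp(q) this leaves exp(- q),
   at most exp(- gamma q) because gamma <= 1. *)
have H1 : mix_rate b beta h l K q <= c1 * expR (- (gamma K * q%:R)).
  rewrite /mix_rate -/sp /c1 [leRHS]mulrDl [X in _ <= X + _]mul1r lerD2l.
  have -> : q%:R * (2 ^- l * (expR (kappa R b * q%:R) * (2 / sp))) =
    (2 / sp) * (q%:R * (2 ^- l * expR (kappa R b * q%:R))) by ring.
  rewrite ler_wpM2l ?divr_ge0 ?(ltW sp0) //.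
  have P1 : q%:R <= expR q%:R :> R.
    by apply: le_trans (expR_ge1Dx _); rewrite lerDr.
  have P2 : 2 ^- l <= expR (- ((kappa R b + 2) * q%:R)).
    rewrite expRN lef_pV2 ?posrE ?exprn_gt0 ?expR_gt0 // expRM_natr.
    apply: (@le_trans _ _ ((2 ^+ k0) ^+ q)).
      by apply: lerXn2r; rewrite ?nnegrE ?expR_ge0 ?exprn_ge0.
    by rewrite -exprM ler_eXn2l ?ltr1n // mulnC leq_divM.
  apply: (@le_trans _ _ (expR q%:R *
      (expR (- ((kappa R b + 2) * q%:R)) * expR (kappa R b * q%:R)))).
    apply: ler_pM => //; first by rewrite mulr_ge0 ?invr_ge0 ?exprn_ge0 ?expR_ge0.
    by rewrite ler_wpM2r ?expR_ge0.
  rewrite -!expRD ler_expR.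
  have : gamma K * q%:R <= 1 * q%:R by rewrite ler_wpM2r.
  lra.
have H0 : 0 <= mix_rate b beta h l K q.
  by rewrite addr_ge0 ?expR_ge0 // !mulr_ge0 ?invr_ge0 ?exprn_ge0 ?expR_ge0 ?sqrtr_ge0.
apply: (@le_trans _ _ ((c1 * expR (- (gamma K * q%:R))) ^+ 2)).
  by apply: lerXn2r; rewrite ?nnegrE // mulr_ge0 ?expR_ge0 ?ltW.
rewrite exprMn -[leRHS]mulrA ler_wpM2l ?sqr_ge0 // -expRM_natl -expRD ler_expR.
have lq : l%:R / k0%:R <= q%:R + 1 :> R.
  by rewrite ler_pdivrMr // natr1 -natrM ler_nat ltnW // ltn_ceil.
have : gamma K * (l%:R / k0%:R) <= gamma K * (q%:R + 1) by rewrite ler_wpM2l // ltW.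
have -> : 2 * gamma K / k0%:R * l%:R = 2 * (gamma K * (l%:R / k0%:R)) by ring.
lra.
Qed.

Lemma VM_of_poincare (R : realType) (b : nat) (beta h : R) (tau : tree b -> bool)
    (r : tree b) (m l q : nat) (C eps : R) : 0 < C ->
  (forall F : conf tau r m -> R, varT beta h F <= C * dirichlet beta h F) ->
  mix_rate b beta h l (Num.max 1 (wratio b beta h ^+ 6 * C)) q ^+ 2 <= eps ->
  VM beta h tau r m l eps.
Proof.
move=> C0 gap He x eta f xT fB; set K := Num.max _ _ in He.
(* The maximum with 1 secures the assumption [1 <= K] of the contraction estimates. *)
have K1 : 1 <= K by rewrite le_max lexx.
apply: le_trans (@variance_mixing _ _ _ _ _ _ _ _ _ eta K xT K1 _ f q fB) _.
  move=> g; rewrite -variance_sqnorm; apply: le_trans (poincare_below x eta C0 gap g) _.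
  rewrite (eq_bigr (fun y => sqnorm beta h (below x) eta g -
     sqnorm beta h (below x) eta (condexp beta h [set y] g))); last first.
    by move=> y yx; rewrite E_variance // sub1set.
  rewrite ler_wpM2r ?le_max ?lexx ?orbT //.
  by apply: sumr_ge0 => y yx; rewrite subr_ge0 sqnorm_E_le // sub1set.
by rewrite ler_wpM2r // variance_ge0.
Qed.

(** Within a block [sqnorm_block] reduces to single sites at a cost depending only on the block
    size, and each site lies in at most l blocks. *)
Lemma dirichlet_block_le (R : realType) (b : nat) (beta h : R)
    (tau : tree b -> bool) (r : tree b) (m l : nat) (f : conf tau r m -> R) :
  dirichlet_block beta h l f <=
    kblock b beta h ^+ #|{: l.-bseq 'I_b}| * l%:R * dirichlet beta h f.
Proof.
rewrite dirichlet_blockE dirichletE.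
pose P A := sqnorm beta h (subtree b m) (tau_conf tau r m) f -
            sqnorm beta h (subtree b m) (tau_conf tau r m) (condexp beta h A f).
have P0 y : y \in subtree b m -> 0 <= P [set y].
  by move=> yT; rewrite subr_ge0 sqnorm_E_le // sub1set.
have k0 : 0 <= kblock b beta h by apply: le_trans (kblock_ge1 _ _ _).
have sub x : block x l \subset subtree b m.
  exact: subset_trans (block_sub x l) (below_sub x).
apply: (@le_trans _ _ (\sum_(x in subtree b m) kblock b beta h ^+ #|{: l.-bseq 'I_b}| *
      \sum_(y | (y \in subtree b m) && (y \in block x l)) P [set y])).
  apply: ler_sum => x _; rewrite (eq_bigl [in block x l]); last first.
    by move=> y /=; case: (boolP (y \in block x l)) => [/(subsetP (sub x)) ->|]; rewrite ?andbF.
  exact: sqnorm_block (sub x) (card_block x l).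
rewrite -mulr_sumr -mulrA ler_wpM2l ?exprn_ge0 //.
(* Extended by 0 off T, because [sum_ancestors] asks for nonnegativity at every vertex. *)
pose F y := if y \in subtree b m then P [set y] else 0.
have -> : \sum_(x in subtree b m) P [set x] = \sum_(x in subtree b m) F x.
  by apply: eq_bigr => x xT; rewrite /F xT.
rewrite (eq_bigr (fun x => \sum_(y | (y \in subtree b m) && (y \in block x l)) F y)); last first.
  by move=> x _; apply: eq_bigr => y /andP[yT _]; rewrite /F yT.
apply: (@sum_ancestors _ _ _ 0 l F (fun x y => (y \in subtree b m) && (y \in block x l))).
  by move=> y; rewrite /F; case: ifP => // /P0.
move=> x y /andP[_]; rewrite inE => /andP[/belowP[ym xy] sy]; split=> //.
by have := prefix_size xy; size_lia.
Qed.

Theorem theorem3p2 (R : realType) (b : nat) (beta h : R)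
    (tau : tree b -> bool) (hb : (2 <= b)%N) (hbeta : 0 <= beta) :
  (forall (l : nat) (delta : R) (r : tree b) (m : nat),
      (1 <= l)%N -> 0 < delta -> delta <= 1 ->
      VM beta h tau r m l ((1 - delta) / (2 * (l%:R + 1 - delta))) ->
      forall f : conf tau r m -> R,
        varT beta h f <= 3 / delta * dirichlet_block beta h l f)
  /\
  ((exists (l : nat) (delta : R),
       [/\ (1 <= l)%N, 0 < delta, delta <= 1 &
           forall (r : tree b) (m : nat),
             VM beta h tau r m l ((1 - delta) / (2 * (l%:R + 1 - delta)))]) ->
   exists C : R, 0 < C /\
     forall (r : tree b) (m : nat), 1 / C <= cgap beta h tau r m)
  /\
  ((exists C : R, 0 < C /\
      forall (r : tree b) (m : nat), 1 / C <= cgap beta h tau r m) ->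
   exists c theta : R, [/\ 0 < c, 0 < theta &
     forall (r : tree b) (m : nat) (l : nat),
       VM beta h tau r m l (c * expR (- (theta * l%:R)))]).
Proof.
have part_a l delta r m : (1 <= l)%N -> 0 < delta -> delta <= 1 ->
    VM beta h tau r m l ((1 - delta) / (2 * (l%:R + 1 - delta))) ->
    forall f : conf tau r m -> R,
      varT beta h f <= 3 / delta * dirichlet_block beta h l f.
  move=> l1 d0 d1 vm f; rewrite varTE dirichlet_blockE.
  exact: var_le_dirichlet_block.
split; first exact: part_a.
split=> [[l [delta [l1 d0 d1 vm]]]|[C [C0 gap]]].
  (* The constant of part (a) times the cost of reducing blocks to sites; neither depends on r or
     m. *)
  pose C := 3 / delta * (kblock b beta h ^+ #|{: l.-bseq 'I_b}| * l%:R).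
  have C0 : 0 < C.
    rewrite /C !mulr_gt0 ?invr_gt0 ?ltr0n ?exprn_gt0 //.
    exact: lt_le_trans ltr01 (kblock_ge1 _ _ _).
  exists C; split=> // r m; apply: gap_of_poincare C0 _ => f.
  apply: le_trans (part_a _ _ _ _ l1 d0 d1 (vm r m) f) _.
  rewrite /C -[leRHS]mulrA ler_wpM2l ?dirichlet_block_le //.
  by rewrite divr_ge0 // ltW.
have K1 : 1 <= Num.max 1 (wratio b beta h ^+ 6 * C) by rewrite le_max lexx.
have [c [theta [c0 theta0 H]]] := mix_rate_exp b beta h K1.
exists c, theta; split=> // r m l; have [q Hq] := H l.
by apply: (VM_of_poincare C0 _ Hq) => F; exact: poincare_of_gap C0 (gap r m).
Qed.
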